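(* Let $\mathcal X$ and $\mathcal Y$ be locally compact Polish spaces. Let $\mathbf X=\{X^n\}_{n\in\mathbb N}\cup\{X\}$ be $\mathcal X$-valued random elements and $\mathbf Y=\{(Y^n_i)_{i\in[1:n]}\}_{n\in\mathbb N}\cup\{Y\}$ a collection of random vectors $Y^n=(Y^n_1,\dots,Y^n_n)$ with entries in $\mathcal Y$ and a $\mathcal Y$-random element $Y$, such that $(\mathbf X,\mathbf Y)$ is $\mathcal X/\mathcal Y$-convenient. Let $\eta_{XY}=\mathrm{Law}(X,Y\mid X)$. Then $$\left(X^n,\eta^n_{XY}\right):=\left(X^n,\frac1n\sum_{j=1}^n\delta_{(X^n,Y^n_j)}\right)\Rightarrow(X,\eta_{XY})\qquad(1)$$ if and only if for every integer $k\ge3$, $$(X^n,Y^n_2,\dots,Y^n_k)\Rightarrow(X,Y^{(2)},\dots,Y^{(k)}),\qquad(2)$$ where $\mathrm{Law}(X,Y^{(j)}\mid X)=\eta_{XY}$ for all $j$ and $Y^{(2)},\dots,Y^{(k)}$ are conditionally independent given $X$. In addition, (2) for $k=3$ alone implies (1).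
   Context: $[1:n]=\{1,\dots,n\}$; $S_n$ is the group of permutations of $[1:n]$; $\Rightarrow$ is convergence in distribution; the space of Borel probability measures on $\mathcal X\times\mathcal Y$ carries the weak topology, and $\mathrm{Law}(X,Y\mid X)$ denotes the (random) conditional law of $(X,Y)$ given $X$. *Continuous dependence.* A random element $V$ depends continuously on a random element $X$ if there is an $X$-almost surely continuous function $\phi$ with $\phi(X)=V$ a.s. *Exchangeability excluding $i$.* For an $\mathcal X$-random element $X$ and $Y=(Y_1,\dots,Y_n)$ with $\mathcal Y$-valued entries, $(X,Y)$ is exchangeable excluding $i$ if $(X,(Y_j)_{j=1}^n)$ and $(X,(Y_{\sigma(j)})_{j=1}^n)$ have the same law for every $\sigma\in S_n$ with $\sigma(i)=i$. *Convenience.* $(\mathbf X,\mathbf Y)$ is $\mathcal X/\mathcal Y$-convenient if for each $n\in\mathbb N$, $(X^n,Y^n)$ is exchangeable excluding $1$, and $\eta_{XY}=\mathrm{Law}(X,Y\mid X)$ depends continuously on $X$. *)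

(* Defs.v *)
From HB Require Import structures.
From mathcomp Require Import all_boot all_order all_algebra all_fingroup.
From mathcomp Require Import all_classical all_reals all_analysis.

Set Implicit Arguments.
Unset Strict Implicit.
Unset Printing Implicit Defensive.

Import Order.TTheory GRing.Theory Num.Theory.
Import numFieldNormedType.Exports.

Local Open Scope classical_set_scope.
Local Open Scope ring_scope.

Definition completely_metrizable (R : realType) (T : topologicalType) : Prop :=
  exists d : T -> T -> R,
    [/\ (forall x y, d x y = 0 <-> x = y),
        (forall x y, d x y = d y x),
        (forall x y z, d x z <= d x y + d y z),
        (forall (x : T) (U : set T),
           nbhs x U <-> exists2 e : R, 0 < e & [set y | d x y < e] `<=` U)
      & (forall u : nat -> T,
           (forall e : R, 0 < e -> exists N : nat, forall m n : nat,
              (N <= m)%N -> (N <= n)%N -> d (u m) (u n) < e) ->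
           exists l : T, u @ \oo --> l)].

Definition polish (R : realType) (T : topologicalType) : Prop :=
  (exists2 D : set T, countable D & dense D) /\ completely_metrizable R T.

(* Needed for Borel sets of T * U: [measurableType] is pointed, and the library
   does not join its pointed and topological structures on products. *)
HB.instance Definition _ (T U : ptopologicalType) := Pointed.on (T * U)%type.

Notation borel T := (g_sigma_algebraType (@open T)).

Definition random_element d (Om : measurableType d) (T : ptopologicalType)
  (V : Om -> T) : Prop := measurable_fun setT (V : Om -> borel T).

(* As the σ-algebra is Borel, this is equality of the induced Borel laws. *)
Definition same_law (R : realType) (T : topologicalType)
    d (Om : measurableType d) (P : probability Om R) (V : Om -> T)
    d' (Om' : measurableType d') (P' : probability Om' R) (V' : Om' -> T) :
    Prop :=
  forall A : set T, <<s @open T >> A -> P (V @^-1` A) = P' (V' @^-1` A).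

Section BorelProbability.
Variables (R : realType) (T : ptopologicalType).

Definition borel_prob : Type := probability (borel T) R.

HB.instance Definition _ := Choice.copy borel_prob (probability (borel T) R).

Definition bounded_continuous : Type :=
  {f : T -> R | continuous f /\ bounded_fun f}.

Definition integrals (mu : borel_prob) : {ptws bounded_continuous -> R} :=
  fun f => \int[mu : probability (borel T) R]_x (sval f x).

(* The weak topology is the coarsest one making mu |-> ∫ f dmu continuous for
   every bounded continuous f.  A [probability] is a function on all sets,
   including non-Borel ones, so Leibniz equality in [borel_prob] is too fine:
   the topology identifies measures that agree on Borel sets. *)
HB.instance Definition _ :=
  Topological.copy borel_prob (initial_topology integrals).

End BorelProbability.

Section EmpiricalMeasure.
Local Open Scope ereal_scope.
Variables (R : realType) (T : ptopologicalType) (n : nat) (z : 'I_n.+1 -> T).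

Definition empirical_fun (A : set (borel T)) : \bar R :=
  (n.+1%:R^-1)%:E * \sum_(j < n.+1) \d_(z j : borel T) A.

Let empirical0 : empirical_fun set0 = 0.
Proof. by rewrite /empirical_fun big1 ?mule0// => j _; rewrite measure0. Qed.

Let empirical_ge0 A : 0 <= empirical_fun A.
Proof.
by rewrite /empirical_fun mule_ge0 ?lee_fin ?invr_ge0 ?ler0n ?sume_ge0.
Qed.

Let empirical_sigma_additive : semi_sigma_additive empirical_fun.
Proof.
pose m (k : nat) : {measure set (borel T) -> \bar R} :=
  \d_(z (inord k) : borel T).
have n0 : (0 <= n.+1%:R^-1 :> R)%R by rewrite invr_ge0 ler0n.
rewrite (_ : empirical_fun = mscale (NngNum n0) (msum m n.+1)).
  exact: measure_semi_sigma_additive.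
apply/funext => A; rewrite /mscale /msum/= /empirical_fun.
by congr (_ * _); apply: eq_bigr => j _; rewrite /m inord_val.
Qed.

HB.instance Definition _ := isMeasure.Build _ _ _ empirical_fun
  empirical0 empirical_ge0 empirical_sigma_additive.

Let empirical_setT : empirical_fun setT = 1.
Proof.
rewrite /empirical_fun (eq_bigr (fun=> 1%:E)); last first.
  by move=> j _; rewrite diracT.
by rewrite sumEFin sumr_const card_ord -EFinM mulVf// pnatr_eq0.
Qed.

HB.instance Definition _ := Measure_isProbability.Build _ _ _ empirical_fun
  empirical_setT.

Definition empirical : borel_prob R T :=
  (empirical_fun : probability (borel T) R).

End EmpiricalMeasure.

Definition cvg_in_dist (R : realType) (T : topologicalType)
    (d : nat -> measure_display) (Om : forall n, measurableType (d n))
    (P : forall n, probability (Om n) R) (V : forall n, Om n -> T)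
    d' (Om' : measurableType d') (P' : probability Om' R) (V' : Om' -> T) :
    Prop :=
  forall F : T -> R, continuous F -> bounded_fun F ->
    ('E_(P n)[F \o V n])%E @[n --> \oo] --> ('E_P'[F \o V'])%E.

Section Conditioning.
Variables (R : realType) (d : measure_display) (Om : measurableType d).
Variables (P : probability Om R) (S : ptopologicalType) (X : Om -> S).

(* g is a version of P(E | X). *)
Definition is_cond_prob (E : set Om) (g : Om -> R) : Prop :=
  measurable_fun setT
    (g : g_sigma_algebra_preimageType (X : Om -> borel S) -> R) /\
  forall A : set (borel S), measurable A ->
    (\int[P]_(w in X @^-1` A) (g w)%:E)%E = P (E `&` X @^-1` A).

(* eta is a (regular) version of Law(Z | X). *)
Definition is_cond_law (T : ptopologicalType) (Z : Om -> T)
    (eta : Om -> borel_prob R T) : Prop :=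
  forall B : set (borel T), measurable B ->
    is_cond_prob (Z @^-1` B)
      (fun w => fine ((eta w : probability (borel T) R) B)).

(* The product rule is required of all versions; taking some B j = setT gives
   it for subfamilies. *)
Definition cond_independent (T : ptopologicalType) (q : nat)
    (Y : 'I_q -> Om -> T) : Prop :=
  forall (B : 'I_q -> set (borel T)) (g : 'I_q -> Om -> R),
    (forall j, measurable (B j)) ->
    (forall j, is_cond_prob (Y j @^-1` B j) (g j)) ->
    is_cond_prob (\bigcap_(j in [set: 'I_q]) (Y j @^-1` B j))
      (fun w => \prod_(j < q) g j w).

(* Continuous dependence on X of a random measure V; phi (X) = V is equality of
   Borel measures. *)
Definition depends_continuously (T : ptopologicalType)
    (V : Om -> borel_prob R T) : Prop :=
  exists phi : S -> borel_prob R T,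
    {ae P, forall w, {for X w, continuous phi}} /\
    {ae P, forall w, forall B : set (borel T), measurable B ->
       (phi (X w) : probability (borel T) R) B =
       (V w : probability (borel T) R) B}.

Definition exchangeable_excluding (T : ptopologicalType) (m : nat) (i : 'I_m)
    (Y : 'I_m -> Om -> T) : Prop :=
  forall s : 'S_m, s i = i ->
    @same_law R (S * {ptws 'I_m -> T})%type
      _ _ P (fun w => (X w, fun j => Y j w))
      _ _ P (fun w => (X w, fun j => Y (s j) w)).

End Conditioning.

(* Throughout, index n : nat stands for the positive integer n.+1, so the n-th
   vector has n.+1 entries and [ord0] is the entry numbered 1. *)
Section Convenience.
Variables (R : realType) (XX YY : ptopologicalType).
Variables (d : nat -> measure_display) (Om : forall n, measurableType (d n)).
Variables (P : forall n, probability (Om n) R).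
Variables (X : forall n, Om n -> XX) (Y : forall n, 'I_n.+1 -> Om n -> YY).
Variables (d' : measure_display) (Om' : measurableType d').
Variables (P' : probability Om' R) (X' : Om' -> XX).
Variable eta : Om' -> borel_prob R (XX * YY)%type.

Definition convenient : Prop :=
  (forall n, exchangeable_excluding (P n) (@X n) ord0 (@Y n)) /\
  depends_continuously P' X' eta.

Definition empirical_cvg : Prop :=
  @cvg_in_dist R (XX * borel_prob R (XX * YY)%type)%type
    _ _ P (fun n w => (X w, empirical R (fun j => (X w, Y j w))))
    _ _ P' (fun w => (X' w, eta w)).

(* (X^n, Y^n_2, .., Y^n_k) => (X, Y^(2), .., Y^(k)) with q = k - 1.  The limit
   Y^(j) live on an extension pi : Om'' -> Om' of the probability space of X,
   to which X and eta are lifted by composition with pi.  Entries 2, .., k of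
   Y^n exist once n >= k; this is the index n = q + m below. *)
Definition tuple_cvg (k : nat) : Prop :=
  let q := k.-1 in
  exists (d'' : measure_display) (Om'' : measurableType d'')
    (P'' : probability Om'' R) (pi : Om'' -> Om') (Yl : 'I_q -> Om'' -> YY),
    [/\ measurable_fun setT pi /\
          (forall A, measurable A -> P'' (pi @^-1` A) = P' A),
        (forall j, random_element (Yl j)),
        (forall j, is_cond_law P'' (X' \o pi) (fun w => (X' (pi w), Yl j w))
                     (eta \o pi)),
        cond_independent P'' (X' \o pi) Yl
      & @cvg_in_dist R (XX * {ptws 'I_q -> YY})%type
          _ _ (fun m => P (q + m))
          (fun m w => (X w, fun j : 'I_q => Y (lift ord0 (lshift m j)) w))
          _ _ P'' (fun w => (X' (pi w), fun j => Yl j w))].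

End Convenience.

(* Main.v *)
(* Write eta^n for the n-th empirical measure, mu f for the integral of f against
   mu.  For continuous u, h_j with values in [0, 1], exchangeability shows that
   E u(X^n) prod_j eta^n(h_j), an average over all index maps, differs from
   E u(X^n) prod_j h_j(X^n, Y^n_(j+1)) by at most the proportion of index maps
   which are not injective or hit the entry 1, which tends to 0.

   (2) for k = 3 implies (1): taking two factors, the second moments
   E u(X^n) eta^n(f) eta^n(g) tend to E u(X) eta(f) eta(g), hence the expectation
   of u(X^n) times the quadratic deviation sum_f (eta^n(f) - phi(x)(f))^2 tends
   to that of u(X) times the deviation of eta, where eta = phi(X) and x is fixed.
   A weak neighbourhood of phi(x) contains a sublevel set of such a deviation, so
   near x a bounded continuous F(X^n, mu) is close to a constant up to a multiple
   of the deviation, and the deviation of phi is small near x by continuity.  These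
   bounds, for countably many x, are glued by a partition of unity.

   (1) implies (2): u(X) prod_j eta(h_j) is a continuous bounded function of
   (X, eta), and products of bump functions determine convergence in law of
   (X, Y_2, .., Y_k).

   Finitely many bump functions from a countable sequence carry all but a small
   mass of the limit law, hence of the approximating laws; this takes over the
   role of tightness. *)

From HB Require Import structures.
From mathcomp Require Import all_boot all_order all_algebra all_fingroup.
From mathcomp Require Import all_classical all_reals all_analysis.
From mathcomp Require Import measurable_realfun giry.
From mathcomp Require Import ring lra.
Require Import Defs.

Set Implicit Arguments.
Unset Strict Implicit.
Unset Printing Implicit Defensive.

Import Order.TTheory GRing.Theory Num.Theory.
Import numFieldNormedType.Exports.

Local Open Scope classical_set_scope.
Local Open Scope ring_scope.

Lemma giry_bindE d1 d (Om : measurableType d1) (T : measurableType d)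
    (R : realType) (P : giry Om R) (K : Om -> giry T R)
    (mK : measurable_fun [set: Om] K) (B : set T) : measurable B ->
  giry_bind P mK B = (\int[P]_w K w B)%E.
Proof.
move=> mB; transitivity (giry_int (giry_bind P mK) (EFin \o \1_B)).
  by rewrite /giry_int integral_indic// setIT.
rewrite giry_int_bind//.
- by apply: eq_integral => w _; rewrite /giry_int integral_indic// setIT.
- exact/measurable_EFinP/measurable_indic.
- by move=> x /=; rewrite lee_fin.
Qed.

Section mixture.
Context d1 d2 d (Om1 : measurableType d1) (Om2 : measurableType d2)
  (T : measurableType d) (R : realType).
Local Open Scope ereal_scope.

(** Each iterated integral is an integral against the sub-probability [giry_bind]. The two measures
    are finite and agree on a pi-system containing the whole space, hence on the sigma-algebra it
    generates. *)
Lemma giry_bind_unique (P1 : giry Om1 R) (P2 : giry Om2 R)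
    (K1 : Om1 -> giry T R) (K2 : Om2 -> giry T R) (G : set (set T)) :
  (forall B, measurable B -> measurable_fun [set: Om1] (K1 ^~ B)) ->
  (forall B, measurable B -> measurable_fun [set: Om2] (K2 ^~ B)) ->
  measurable = <<s G >> -> setI_closed G -> G setT ->
  (forall B, G B -> \int[P1]_w K1 w B = \int[P2]_w K2 w B) ->
  forall f : T -> \bar R, measurable_fun [set: T] f -> (forall x, 0 <= f x) ->
  \int[P1]_w \int[K1 w]_x f x = \int[P2]_w \int[K2 w]_x f x.
Proof.
move=> mK1 mK2 mG GI GT KG f mf f0.
have mk1 : measurable_fun [set: Om1] K1 by exact: measurable_giry_codensity.
have mk2 : measurable_fun [set: Om2] K2 by exact: measurable_giry_codensity.
transitivity (giry_int (giry_bind P1 mk1) f).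
  by rewrite giry_int_bind.
transitivity (giry_int (giry_bind P2 mk2) f); last by rewrite giry_int_bind.
rewrite /giry_int; apply: eq_measure_integral => A mA _.
apply: (measure_unique G (fun=> setT)) => //.
- by rewrite bigcup_const//; exists 0%N.
- move=> B GB; have mB : measurable B by rewrite mG; exact: sub_sigma_algebra.
  exact: etrans (giry_bindE P1 mk1 mB)
    (etrans (KG B GB) (esym (giry_bindE P2 mk2 mB))).
- move=> _.
  by rewrite (le_lt_trans (@sprobability_setT _ _ _ (giry_bind P1 mk1)))// ltry.
Qed.

End mixture.

Section wscale.
Context d (T : measurableType d) (R : realType) (r : R) (m : probability T R).
Hypothesis r01 : (0 <= r <= 1)%R.
Local Open Scope ereal_scope.

Let r0 : (0 <= r)%R. Proof. by case/andP: r01. Qed.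

(** The elements of [giry] are sub-probabilities, so a weight in [0, 1] can be absorbed into a
    kernel. Weighted laws thereby become mixtures. *)
Definition wscale_fun of (0 <= r <= 1)%R : set T -> \bar R := mscale (NngNum r0) m.

HB.instance Definition _ := Measure.on (wscale_fun r01).

Let wscale_setT : wscale_fun r01 setT <= 1.
Proof.
rewrite /wscale_fun /mscale/= probability_setT mule1 lee_fin.
by case/andP: r01.
Qed.

HB.instance Definition _ := Measure_isSubProbability.Build _ _ _
  (wscale_fun r01) wscale_setT.

Definition wscale : giry T R := wscale_fun r01.

Lemma wscaleE B : wscale B = r%:E * m B. Proof. by []. Qed.

Lemma integral_wscale (f : T -> \bar R) :
  measurable_fun [set: T] f -> (forall x, 0 <= f x) ->
  \int[wscale]_x f x = r%:E * \int[m]_x f x.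
Proof. by move=> mf f0; rewrite /wscale/= ge0_integral_mscale. Qed.

End wscale.

Section mixture_real.
Context d1 d2 d (Om1 : measurableType d1) (Om2 : measurableType d2)
  (T : measurableType d) (R : realType).
Variables (P1 : probability Om1 R) (P2 : probability Om2 R).

(** Values in [0, 1] are stable under products and make measurable functions integrable. *)
Definition unit_valued (U : Type) (f : U -> R) := forall x, 0 <= f x <= 1.

Lemma unit_integrable (m : probability T R) (f : T -> R) :
  measurable_fun [set: T] f -> unit_valued f ->
  m.-integrable setT (EFin \o f).
Proof.
move=> mf f01; apply: measurable_bounded_integrable => //.
  by rewrite (le_lt_trans (probability_le1 _ _))// ltry.
by exists 1; split => // M M1 x _ /=; have /andP[f0 f1] := f01 x;
  rewrite ger0_norm// (le_trans f1)// ltW.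
Qed.

Lemma unit_RintegralE (m : probability T R) (f : T -> R) :
  measurable_fun [set: T] f -> unit_valued f ->
  (\int[m]_x f x)%:E = (\int[m]_x (f x)%:E)%E.
Proof.
by move=> mf f01; rewrite fineK//; apply: integrable_fin_num => //;
  exact: unit_integrable.
Qed.

Lemma unit_Rintegral (m : probability T R) (f : T -> R) :
  measurable_fun [set: T] f -> unit_valued f -> 0 <= \int[m]_x f x <= 1.
Proof.
move=> mf f01; rewrite Rintegral_ge0//=; last by move=> x _; case/andP: (f01 x).
rewrite -lee_fin unit_RintegralE// -(@probability_setT _ _ _ m).
rewrite -[leRHS]mul1e -integral_cst//.
apply: ge0_le_integral => //.
- by move=> x _; rewrite lee_fin; case/andP: (f01 x).
- exact/measurable_EFinP.
- by move=> x _; rewrite lee_fin; case/andP: (f01 x).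
Qed.

Lemma Rintegral_indic (m : probability T R) (B : set T) : measurable B ->
  \int[m]_x \1_B x = fine (m B).
Proof. by move=> mB; rewrite /Rintegral integral_indic// setIT. Qed.

(** The left side mixes weighted Dirac masses at [V w], the right side the weighted measures [k w].
    With [V] a pair (X, Y_j), an identity tested on rectangles is upgraded to all measurable
    functions with values in [0, 1]. *)
Lemma dirac_mixture_unique (V : Om1 -> T) (W1 : Om1 -> R) (W2 : Om2 -> R)
    (k : Om2 -> probability T R) (G : set (set T)) :
  measurable_fun [set: Om1] V -> measurable_fun [set: Om1] W1 ->
  measurable_fun [set: Om2] W2 -> unit_valued W1 -> unit_valued W2 ->
  (forall B, measurable B -> measurable_fun [set: Om2] (fun w => k w B)) ->
  measurable = <<s G >> -> setI_closed G -> G setT ->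
  (forall B, G B -> \int[P1]_w (W1 w * \1_B (V w))%:E =
                    \int[P2]_w (W2 w * \int[k w]_x \1_B x)%:E)%E ->
  forall f : T -> R, measurable_fun [set: T] f -> unit_valued f ->
  (\int[P1]_w (W1 w * f (V w))%:E = \int[P2]_w (W2 w * \int[k w]_x f x)%:E)%E.
Proof.
move=> mV mW1 mW2 W101 W201 mk mG GI GT KG f mf f01.
pose K1 w := wscale (\d_(V w)) (W101 w).
pose K2 w := wscale (k w) (W201 w).
have GmB B : G B -> measurable B by move=> ?; rewrite mG; exact: sub_sigma_algebra.
have mEf : measurable_fun [set: T] (EFin \o f) by exact/measurable_EFinP.
have Ef0 x : (0 <= (EFin \o f) x)%E by rewrite lee_fin; case/andP: (f01 x).
transitivity (\int[P1]_w \int[K1 w]_x (f x)%:E)%E.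
  apply: eq_integral => w _; rewrite integral_wscale//=.
  by rewrite integral_dirac// diracT mul1e EFinM.
transitivity (\int[P2]_w \int[K2 w]_x (f x)%:E)%E; last first.
  apply: eq_integral => w _; rewrite integral_wscale//=.
  by rewrite EFinM unit_RintegralE.
apply: (giry_bind_unique (G := G)) => //.
- move=> B mB; rewrite /K1.
  under eq_fun do rewrite wscaleE.
  apply: emeasurable_funM; first exact/measurable_EFinP.
  exact: measurableT_comp (measurable_fun_dirac mB) mV.
- move=> B mB; rewrite /K2.
  under eq_fun do rewrite wscaleE.
  by apply: emeasurable_funM; [exact/measurable_EFinP|exact: mk].
- move=> B GB; have mB := GmB _ GB; have := KG B GB.
  under eq_integral do rewrite EFinM.
  under [in RHS]eq_integral do rewrite Rintegral_indic// EFinM fineK ?fin_num_measure//.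
  by [].
Qed.

End mixture_real.

(** The case of Dirac kernels, with all measurable sets as the pi-system. *)
Lemma weighted_law_unique d1 d2 d (Om1 : measurableType d1)
    (Om2 : measurableType d2) (T : measurableType d) (R : realType)
    (P1 : probability Om1 R) (P2 : probability Om2 R)
    (V1 : Om1 -> T) (V2 : Om2 -> T) (W1 : Om1 -> R) (W2 : Om2 -> R) :
  measurable_fun [set: Om1] V1 -> measurable_fun [set: Om2] V2 ->
  measurable_fun [set: Om1] W1 -> measurable_fun [set: Om2] W2 ->
  unit_valued W1 -> unit_valued W2 ->
  (forall B, measurable B -> \int[P1]_w (W1 w * \1_B (V1 w))%:E =
                             \int[P2]_w (W2 w * \1_B (V2 w))%:E)%E ->
  forall f : T -> R, measurable_fun [set: T] f -> unit_valued f ->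
  (\int[P1]_w (W1 w * f (V1 w))%:E = \int[P2]_w (W2 w * f (V2 w))%:E)%E.
Proof.
move=> mV1 mV2 mW1 mW2 W101 W201 VV f mf f01.
have dE h : measurable_fun [set: T] h ->
    (\int[P2]_w (W2 w * \int[\d_(V2 w)]_x h x)%:E =
     \int[P2]_w (W2 w * h (V2 w))%:E)%E.
  move=> mh; apply: eq_integral => w _; rewrite /Rintegral integral_dirac//.
    by rewrite diracT mul1e.
  exact/measurable_EFinP.
rewrite -dE//.
apply: (@dirac_mixture_unique _ _ _ _ _ _ _ P1 P2 V1 W1 W2
  (fun w => \d_(V2 w)) measurable) => //.
- by move=> B mB; exact: measurableT_comp (measurable_fun_dirac mB) mV2.
- by rewrite sigma_algebra_id//; exact: sigma_algebra_measurable.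
- exact: measurableI.
- by move=> B mB; rewrite dE ?VV//; exact: measurable_indic.
Qed.

(** * Monotonicity of the integral without measurability *)

Section nonmeasurable_integral.
Context d (T : measurableType d) (R : realType) (mu : {measure set T -> \bar R}).
Import HBNNSimple.
Local Open Scope ereal_scope.

(* The simple functions below [f] are below [g] once cut off on the null set. *)
Let ge0_le_integral_ae (f g : T -> \bar R) :
  (forall x, 0 <= f x) -> (forall x, 0 <= g x) ->
  {ae mu, forall x, f x <= g x} -> \int[mu]_x f x <= \int[mu]_x g x.
Proof.
move=> f0 g0 [N [mN N0 fgN]].
rewrite [leLHS]ge0_integralTE//; apply: ge_ereal_sup => _ [h /= hf <-].
rewrite [leRHS]ge0_integralTE//; apply: ereal_sup_ge.
have mNC : measurable (~` N) by exact: measurableC.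
pose h' := proj_nnsfun h mNC.
exists (sintegral mu h') => //.
  exists h' => //= x; rewrite mindicE.
  have [xN|xN] := boolP (x \in ~` N); last by rewrite mulr0.
  rewrite mulr1 (le_trans (hf x))//; apply: contrapT => /fgN.
  by move: xN; rewrite inE.
rewrite -!integralT_nnsfun le_eqVlt; apply/orP; left; apply/eqP.
apply: ge0_ae_eq_integral => //.
- exact/measurable_EFinP.
- exact/measurable_EFinP.
- by move=> x _; rewrite lee_fin.
- by move=> x _; rewrite lee_fin.
exists N; split => // x /= hx; apply: contrapT => Nx; apply: hx => _.
by rewrite mindicE mem_set// mulr1.
Qed.

(** Applied below to expectations of continuous functions of random measures, for which
    measurability is not at hand. *)
Lemma ae_le_integral (f g : T -> \bar R) :
  {ae mu, forall x, f x <= g x} -> \int[mu]_x f x <= \int[mu]_x g x.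
Proof.
move=> fg; rewrite integralE [leRHS]integralE leeB//.
- apply: ge0_le_integral_ae => //; apply: filterS fg => x fgx.
  by rewrite !funeposE ge_max !le_max fgx lexx orbT.
- apply: ge0_le_integral_ae => //; apply: filterS fg => x fgx.
  by rewrite !funenegE ge_max !le_max leeN2 fgx lexx orbT.
Qed.

End nonmeasurable_integral.

Lemma gt0_integral_le0_null d (T : measurableType d) (R : realType)
    (mu : {measure set T -> \bar R}) (N : set T) (h : T -> R) :
  measurable N -> measurable_fun N h -> (forall x, N x -> 0 < h x) ->
  (\int[mu]_(x in N) (h x)%:E <= 0)%E -> mu N = 0%E.
Proof.
move=> mN mh h0 ih.
have /(ae_eq_integral_abs _ mN) : (\int[mu]_(x in N) `|(h x)%:E| = 0)%E.
  apply/eqP; rewrite eq_le; apply/andP; split; last exact: integral_ge0.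
  rewrite (eq_integral (fun x => (h x)%:E))// => x /set_mem Nx.
  by rewrite gee0_abs// lee_fin ltW// h0.
move=> /(_ _)-/(_ (proj2 (measurable_EFinP _ _) mh)) ae0.
apply: measure_negligible => //; apply: negligibleS ae0 => x Nx /= /(_ Nx) [hx].
by have := h0 _ Nx; rewrite hx ltxx.
Qed.

(** * Almost sure uniqueness of conditional probabilities *)

Section conditional_probability_unique.
Context (R : realType) d (Om : measurableType d) (P : probability Om R)
  (S : ptopologicalType) (X : Om -> S).
Hypothesis rX : random_element X.

Notation sX := (g_sigma_algebra_preimageType (X : Om -> borel S)).

Lemma preimage_measurable_fun (d2 : measure_display) (U : measurableType d2)
    (g : Om -> U) :
  measurable_fun [set: sX] (g : sX -> U) -> measurable_fun [set: Om] g.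
Proof.
move=> mg _ A mA; rewrite setTI.
have [B mB] := mg measurableT A mA; rewrite !setTI => <-.
by rewrite -[_ @^-1` _]setTI; exact: rX.
Qed.

Let preimage_lt (f g : Om -> R) :
  measurable_fun [set: sX] (f : sX -> R) ->
  measurable_fun [set: sX] (g : sX -> R) ->
  exists2 B : set (borel S), measurable B & X @^-1` B = [set w | f w < g w].
Proof.
move=> mf mg.
have := measurable_fun_ltr mf mg measurableT (Y := [set true]) I.
by case=> B mB XB; exists B => //; move: XB; rewrite !setTI.
Qed.

Let preimage_measurable (B : set (borel S)) :
  measurable B -> measurable (X @^-1` B).
Proof. by move=> mB; rewrite -[_ @^-1` _]setTI; exact: rX. Qed.

(** The set where [g] is negative is the preimage of a Borel set under [X], so the integral of [g]
    over it is a probability and cannot be negative. *)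
Let cond_prob_ge0_ae (E : set Om) (g : Om -> R) :
  is_cond_prob P X E g -> P [set w | (g w < 0)%R] = 0%E.
Proof.
move=> [mg Eg].
have [B mB NB] := preimage_lt mg (measurable_cst (0 : R)).
have mN := preimage_measurable mB; rewrite NB in mN.
have mg' := preimage_measurable_fun mg.
apply: (gt0_integral_le0_null (h := fun w => - g w)) => //.
- exact/measurable_funTS/measurableT_comp.
- by move=> w /=; rewrite oppr_gt0.
rewrite -[leLHS]oppeK -integral_ge0N; last first.
  by move=> w /= /ltW gw; rewrite lee_fin oppr_ge0.
under eq_integral do rewrite EFinN oppeK.
by rewrite -NB Eg// oppe_le0.
Qed.

(** Versions are not assumed integrable or nonnegative, so the two integral identities cannot be
    subtracted at once. The null set where [g'] is negative is removed first; on the rest the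
    integral of [g] splits into those of [g'] and [g - g'], and the common value is a finite
    probability. *)
Let lt_null (E : set Om) (g g' : Om -> R) : measurable E ->
  is_cond_prob P X E g -> is_cond_prob P X E g' ->
  P [set w | (g' w < g w)%R] = 0%E.
Proof.
move=> mE Pg Pg'; have [mg Eg] := Pg; have [mg' Eg'] := Pg'.
have [B mB NB] := preimage_lt mg' mg.
have [C mC NC] := preimage_lt mg' (measurable_cst (0 : R)).
have mN := preimage_measurable mB.
have mNC := preimage_measurable mC.
have mBC : measurable (B `\` C) by exact: measurableD.
have mXBC := preimage_measurable mBC.
have h0 w : (X @^-1` (B `\` C)) w -> 0 <= g' w < g w.
  move=> [Bw Cw].
  have -> : g' w < g w by move: Bw; rewrite -[B _]/((X @^-1` B) w) NB.
  rewrite andbT leNgt; apply/negP => gw; apply: Cw.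
  by rewrite -[C _]/((X @^-1` C) w) NC.
have mfg := preimage_measurable_fun mg.
have mfg' := preimage_measurable_fun mg'.
have D0 : P (X @^-1` (B `\` C)) = 0%E.
  apply: (gt0_integral_le0_null (h := fun w => g w - g' w)) => //.
  - by apply: measurable_funTS; exact: measurable_funB.
  - by move=> w /h0/andP[_]; rewrite subr_gt0.
  have := Eg _ mBC; rewrite -Eg'//.
  have -> : (\int[P]_(w in X @^-1` (B `\` C)) (g w)%:E =
      \int[P]_(w in X @^-1` (B `\` C)) (g' w)%:E +
      \int[P]_(w in X @^-1` (B `\` C)) (g w - g' w)%:E)%E.
    rewrite -ge0_integralD//.
    + by apply: eq_integral => w _; rewrite -EFinD addrC subrK.
    + by move=> w /h0/andP[]; rewrite lee_fin.
    + by apply/measurable_EFinP; exact: measurable_funTS.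
    + by move=> w /h0/andP[_ /ltW]; rewrite lee_fin subr_ge0.
    + by apply/measurable_EFinP/measurable_funTS; exact: measurable_funB.
  have Efin : P (E `&` X @^-1` (B `\` C)) \is a fin_num.
    by apply: fin_num_measure; exact: measurableI.
  rewrite Eg'// addeC => /(congr1 (fun z => z - P (E `&` X @^-1` (B `\` C)))%E).
  by rewrite addeK// subee// => <-.
rewrite (_ : [set w | (g' w < g w)%R] =
    X @^-1` (B `\` C) `|` X @^-1` C `&` X @^-1` B); last first.
  rewrite -NB; apply/seteqP; split => w.
    by have [Cw|nCw] := pselect (C (X w)); [right|left].
  by move=> [[]|[]].
apply/eqP; rewrite -measure_le0 (le_trans (measureU2 _ _ _))//.
  exact: measurableI.
rewrite [X in (X + _)%E]D0 add0e -(cond_prob_ge0_ae Pg') le_measure ?inE//.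
- exact: measurableI.
- by rewrite NC in mNC.
- by rewrite NC => w [].
Qed.

Lemma cond_prob_unique (E : set Om) (g g' : Om -> R) : measurable E ->
  is_cond_prob P X E g -> is_cond_prob P X E g' -> {ae P, forall w, g w = g' w}.
Proof.
move=> mE Pg Pg'.
have mlt (f f' : Om -> R) : is_cond_prob P X E f -> is_cond_prob P X E f' ->
    measurable [set w | (f' w < f w)%R].
  move=> [mf _] [mf' _]; have [B mB <-] := preimage_lt mf' mf.
  exact: preimage_measurable.
exists ([set w | (g' w < g w)%R] `|` [set w | (g w < g' w)%R]); split.
- by apply: measurableU; exact: mlt.
- apply/eqP; rewrite -measure_le0 (le_trans (measureU2 _ _ _))//.
  + exact: mlt.
  + exact: mlt.
  + by rewrite [X in (X + _)%E](lt_null mE Pg Pg') add0e [leLHS](lt_null mE Pg' Pg).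
- by move=> w /= /eqP; rewrite neq_lt => /orP[|]; [right|left].
Qed.

End conditional_probability_unique.

(** * Countable families of bump functions on Polish spaces *)

Section bumps.
Context (R : realType) (T : ptopologicalType).

(* A countable substitute for a base of the topology. *)
Definition bump_sequence (beta : nat -> T -> R) : Prop :=
  [/\ forall l, continuous (beta l),
      forall l, unit_valued (beta l) &
      forall x (U : set T), nbhs x U ->
        exists2 l, beta l x = 1 & forall y, beta l y != 0 -> U y].

Let clamp (a : R) := Num.min 1 (Num.max 0 a).

Let clamp01 a : 0 <= clamp a <= 1.
Proof. by rewrite /clamp le_min ge_min ler01 lexx/= le_max lexx. Qed.

Let clamp_lip a b : `|clamp a - clamp b| <= `|a - b|.
Proof.
wlog ab : a b / a <= b.
  move=> wl; have [|/ltW] := leP a b; first exact: wl.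
  by rewrite (distrC (clamp a)) (distrC a); exact: wl.
rewrite (distrC (clamp a)) (distrC a) (ger0_norm (_ : 0 <= b - a)) ?subr_ge0//.
rewrite /clamp ler_norml.
have [a0|a0] := leP a 0; have [b0|b0] := leP b 0;
  [have [?|?] := leP 1 (0 : R)|have [?|?] := leP 1 (0 : R); have [?|?] := leP 1 b
  |have [?|?] := leP 1 a; have [?|?] := leP 1 (0 : R)
  |have [?|?] := leP 1 a; have [?|?] := leP 1 b]; lra.
Qed.

Lemma polish_bump_sequence : polish R T -> exists beta, bump_sequence beta.
Proof.
move=> [[D cD dD] [d [d0 dC dT dN _]]].
have dge0 x y : 0 <= d x y.
  have := dT x y x; rewrite (proj2 (d0 x x) erefl).
  by rewrite (dC y x); lra.
have dxx x : d x x = 0 by exact: (proj2 (d0 x x) erefl).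
have [f finj] := countable_injP _ cD.
(* A left inverse of the enumeration [f] of [D]. At other indices [get] gives some default point,
   which only adds harmless bumps. *)
pose q l := get [set x | D x /\ f x = l].
have qE x : D x -> q (f x) = x.
  move=> Dx; have [Dq fq] : [set y | D y /\ f y = f x] (q (f x)).
    by apply: (@getI _ [set y | D y /\ f y = f x] x).
  by apply: finj => //; rewrite inE.
(* Equal to 1 within [1 / (m + 1)] of the centre and to 0 beyond [2 / (m + 1)]. *)
pose b (im : nat * nat) x := clamp (2 - im.2.+1%:R * d x (q im.1)).
exists (fun l => if unpickle l is Some im then b im else cst 0); split.
- move=> l; case: unpickle => [[i m]|]; last exact: cst_continuous.
  move=> x; apply/cvgrPdist_lt => e e0; apply/dN.
  exists (e / m.+1%:R); first by rewrite divr_gt0.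
  move=> y /=; rewrite ltr_pdivlMr// => dxy.
  rewrite (le_lt_trans (clamp_lip _ _))// (le_lt_trans _ dxy)//.
  rewrite (_ : _ - _ = (d y (q i) - d x (q i)) * m.+1%:R) /=; last by ring.
  rewrite normrM (@ger0_norm _ m.+1%:R)// ler_wpM2r// ler_norml.
  have := dT y x (q i); have := dT x y (q i); rewrite (dC y x).
  by lra.
- by move=> l x; case: unpickle => [[i m]|/=]; rewrite ?clamp01// lexx ler01.
- move=> x U /dN[e e0 eU].
  (* Three radii: a centre lies within [1 / (m + 1)] of [x], and the support of its bump within
     [2 / (m + 1)] of the centre. *)
  pose m := Num.truncn (3 / e).
  have me : 3 / m.+1%:R < e.
    by rewrite ltr_pdivrMr// mulrC -ltr_pdivrMr// truncnS_gt.
  have [y [Dy /= dxy]] : D `&` [set y | d x y < m.+1%:R^-1] !=set0.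
    have nx : nbhs x [set y | d x y < m.+1%:R^-1] by apply/dN; exists m.+1%:R^-1.
    have [z [/interior_subset xz Dz]] :=
      dD _ (ex_intro _ x nx) (open_interior _).
    by exists z.
  have m0 : 0 < m.+1%:R :> R by [].
  have my : m.+1%:R * d x y <= 1.
    by rewrite mulrC -ler_pdivlMr// div1r ltW.
  exists (pickle (f y, m)); rewrite pickleK /b/= qE//.
    by rewrite /clamp; apply/min_idPl; rewrite le_max; apply/orP; right; lra.
  move=> z bz; apply: eU => /=; rewrite (le_lt_trans _ me)//.
  rewrite ler_pdivlMr//.
  have zy : m.+1%:R * d z y <= 2.
    rewrite leNgt; apply/negP => zy; move: bz; rewrite /clamp.
    by rewrite (max_idPl _) ?(min_idPr _) ?eqxx//; lra.
  have := dT x y z; rewrite (dC y z) mulrC -(ler_pM2l m0) mulrDr; lra.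
Qed.

End bumps.

(** * Borel sets and neighbourhoods in products *)

Section borel_functions.
Context (R : realType).

Lemma continuous_borel (T U : ptopologicalType) (f : T -> U) :
  continuous f -> measurable_fun [set: borel T] (f : borel T -> borel U).
Proof.
move=> /continuousP cf; apply: (@measurability _ _ (borel T) (borel U) setT f (@open U)) => //.
move=> _ [B oB <-]; rewrite setTI; apply: sub_sigma_algebra.
exact: cf.
Qed.

Lemma continuous_borel_real (T : ptopologicalType) (f : T -> R) :
  continuous f -> measurable_fun [set: borel T] f.
Proof.
move=> /continuousP cf.
apply: (measurability _ (RGenOInfty.measurableE R)) => _ [_ [x ->] <-].
rewrite setTI; apply: sub_sigma_algebra; apply: cf.
by rewrite set_itvE; exact: open_gt.
Qed.

Lemma continuous_random_real d (Om : measurableType d) (T : ptopologicalType)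
    (f : T -> R) (V : Om -> T) :
  continuous f -> random_element V -> measurable_fun [set: Om] (f \o V).
Proof. by move=> /continuous_borel_real mf mV; exact: measurableT_comp mf mV. Qed.

Lemma continuous_prod (T : topologicalType) (I : Type) (s : seq I)
    (f : I -> T -> R) :
  (forall i, continuous (f i)) -> continuous (fun x => \prod_(i <- s) f i x).
Proof.
by move=> cf; apply: continuous_big => //; exact: mul_continuous.
Qed.

Lemma continuous_sum (T : topologicalType) (I : Type) (s : seq I)
    (f : I -> T -> R) :
  (forall i, continuous (f i)) -> continuous (fun x => \sum_(i <- s) f i x).
Proof.
by move=> cf; apply: continuous_big => //; exact: add_continuous.
Qed.

End borel_functions.

Section borel_product.
Context (R : realType) (S T : ptopologicalType).
Variables (beta : nat -> S -> R) (gamma : nat -> T -> R).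
Hypotheses (bbeta : bump_sequence beta) (bgamma : bump_sequence gamma).

Definition borel_rect : set (set (S * T)) :=
  [set A `*` C | A in @measurable _ (borel S) & C in @measurable _ (borel T)].

Lemma borel_rect_setI : setI_closed borel_rect.
Proof.
move=> _ _ [A mA [C mC <-]] [A' mA' [C' mC' <-]].
exists (A `&` A'); first exact: measurableI.
by exists (C `&` C'); [exact: measurableI|rewrite setXI].
Qed.

Lemma borel_rectT : borel_rect setT.
Proof. by exists setT => //; exists setT => //; rewrite setXTT. Qed.

Lemma borel_rect_measurable B :
  borel_rect B -> @measurable _ (borel (S * T)%type) B.
Proof.
move=> [A mA [C mC <-]].
have m1 := @continuous_borel (S * T)%type S fst (fun=> cvg_fst).
have m2 := @continuous_borel (S * T)%type T snd (fun=> cvg_snd).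
have -> : A `*` C = (fst @^-1` A) `&` (snd @^-1` C) by [].
by apply: measurableI; rewrite -[_ @^-1` _]setTI; [exact: m1|exact: m2].
Qed.

Let bump_eq1 (V : ptopologicalType) (b : V -> R) : continuous b ->
  @measurable _ (borel V) [set x | b x = 1].
Proof.
move=> /continuous_borel_real /(_ measurableT [set 1] (measurable_set1 1)).
by rewrite setTI.
Qed.

(** An open [U] is the union of the rectangles on which two bumps equal 1, over those of the
    countably many pairs of bumps whose joint support lies in [U]. *)
Lemma borel_prodE : @measurable _ (borel (S * T)%type) = <<s borel_rect >>.
Proof.
apply/seteqP; split; last first.
  apply: smallest_sub; first exact: sigma_algebra_measurable.
  exact: borel_rect_measurable.
apply: smallest_sub; first exact: smallest_sigma_algebra.
move=> U oU; have [cb _ bb] := bbeta; have [cg _ gg] := bgamma.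
have -> : U = \bigcup_(lk in [set lk : nat * nat |
    forall z, beta lk.1 z.1 != 0 -> gamma lk.2 z.2 != 0 -> U z])
    ([set x | beta lk.1 x = 1] `*` [set x | gamma lk.2 x = 1]).
  apply/seteqP; split=> [[x y] Uxy|[x y] [[l k] lkU [/= lx ky]]]; last first.
    by apply: lkU => /=; rewrite ?lx ?ky oner_neq0.
  have [[A C]/= [nA nC] ACU] := open_nbhs_nbhs (conj oU Uxy).
  have [l lx lA] := bb _ _ nA; have [k ky kC] := gg _ _ nC.
  by exists (l, k) => // z /= /lA zA /kC zC; exact: ACU.
rewrite bigcup_mkcond.
apply: (@countable_bigcupT_measurable _ (g_sigma_algebraType borel_rect)) => //.
move=> [l k]; case: ifP => // _; apply: sub_sigma_algebra.
by exists [set x | beta l x = 1]; [exact: bump_eq1|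
  exists [set x | gamma k x = 1]; [exact: bump_eq1|]].
Qed.

Lemma random_element_pair d (Om : measurableType d) (X : Om -> S) (Y : Om -> T) :
  random_element X -> random_element Y ->
  random_element (fun w => (X w, Y w)).
Proof.
move=> rX rY; apply: (@measurability _ _ Om (borel (S * T)%type) setT _ borel_rect).
  exact: borel_prodE.
move=> _ [_ [A mA [C mC <-]] <-]; rewrite setTI.
have -> : (fun w => (X w, Y w)) @^-1` (A `*` C) = (X @^-1` A) `&` (Y @^-1` C).
  by [].
by apply: measurableI; rewrite -[_ @^-1` _]setTI; [exact: rX|exact: rY].
Qed.

End borel_product.

(** The pointwise topology is the supremum of the topologies pulled back by the coordinates, so it
    is enough to treat a subbasic set, for which a box restricting one coordinate will do. *)
Lemma ptws_nbhs_box (I : choiceType) (T : ptopologicalType)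
    (y : {ptws I -> T}) (W : set {ptws I -> T}) : nbhs y W ->
  exists2 V : I -> set T, forall i, nbhs (y i) (V i) &
    forall z, (forall i, V i (z i)) -> W z.
Proof.
pose box (V : I -> set T) : set {ptws I -> T} := [set z | forall i, V i (z i)].
pose F := filter_from [set V : I -> set T | forall i, nbhs (y i) (V i)] box.
have FF : Filter F.
  apply: filter_from_filter; first by exists (fun=> setT) => i; exact: filterT.
  move=> V1 V2 n1 n2; exists (fun i => V1 i `&` V2 i).
    by move=> i; exact: filterI.
  by move=> z Vz; split=> i; have [] := Vz i.
have Fy : F --> (y : {ptws I -> T}).
  apply/cvg_sup => i A [B [[C oC <-] Cy] CA].
  have nC : nbhs (y i) C by exact: open_nbhs_nbhs.
  exists (dfwith (fun=> setT) i C).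
    move=> j /=; have [->|ji] := eqVneq j i; first by rewrite dfwithin.
    by rewrite dfwithout 1?eq_sym//; exact: filterT.
  by move=> z /(_ i); rewrite dfwithin => /CA.
by move=> /Fy [V nV VW]; exists V.
Qed.

(** * Quadratic neighbourhoods in the weak topology *)

Section weak_topology.
Context (R : realType) (T : ptopologicalType).
Implicit Types (mu : borel_prob R T).

Definition unit_continuous : Type :=
  {f : T -> R | continuous f /\ unit_valued f}.
Implicit Types f : unit_continuous.

Definition unit_integral mu f : R := \int[mu : probability (borel T) R]_x sval f x.

Lemma unit_continuous_bounded f : continuous (sval f) /\ bounded_fun (sval f).
Proof.
have [cf f01] := svalP f; split=> //.
by exists 1; split=> // M M1 x _ /=; have /andP[f0 f1] := f01 x;
  rewrite ger0_norm// (le_trans f1)// ltW.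
Qed.

Lemma unit_integral_continuous f : continuous (unit_integral ^~ f).
Proof.
move=> mu; pose f' : bounded_continuous R T := exist _ _ (unit_continuous_bounded f).
apply: (@continuous_comp _ _ _ (@integrals R T)
  (proj f' : {ptws bounded_continuous R T -> R} -> R)).
  exact: initial_continuous.
exact: (@proj_continuous {classic bounded_continuous R T} (fun=> R) f').
Qed.

Lemma unit_integral01 mu f : 0 <= unit_integral mu f <= 1.
Proof.
have [cf f01] := svalP f.
by apply: unit_Rintegral => //; exact: continuous_borel_real.
Qed.

Lemma eq_unit_integral mu mu' f :
  (forall B : set (borel T), measurable B ->
    (mu : probability (borel T) R) B = (mu' : probability (borel T) R) B) ->
  unit_integral mu f = unit_integral mu' f.
Proof.
move=> mm'; congr fine; apply: eq_measure_integral => B mB _; exact: mm'.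
Qed.

Lemma bounded_funP (U : Type) (f : U -> R) :
  bounded_fun f -> exists2 M, 0 < M & forall x, `|f x| <= M.
Proof.
move=> [M [_ fM]]; exists (`|M| + 1); first by rewrite ltr_pwDr.
move=> x; apply: fM => //.
by rewrite (le_lt_trans (ler_norm _))// ltrDl.
Qed.

(** [Mg.1] is a bound [M] of [|f|], and [Mg.2] is the affine image [(f + M) / (2 M)] of [f]. *)
Lemma integrals_unit (f : bounded_continuous R T) :
  exists2 Mg : R * unit_continuous, 0 < Mg.1 &
    forall mu, integrals mu f = 2 * Mg.1 * unit_integral mu Mg.2 - Mg.1.
Proof.
have [cf /bounded_funP[M M0 fM]] := svalP f.
pose g x := (sval f x + M) / (2 * M).
have cg : continuous g.
  by move=> x; apply: cvgMl; apply: cvgD; [exact: cf|exact: cvg_cst].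
have g01 : unit_valued g.
  move=> x; have := fM x; rewrite ler_norml => /andP[h1 h2].
  by rewrite divr_ge0 ?ler_pdivrMr/=; lra.
exists (M, exist _ g (conj cg g01)) => //= mu.
have mg := continuous_borel_real cg.
have ig := unit_integrable (mu : probability (borel T) R) mg g01.
rewrite /integrals /unit_integral/= -RintegralZl//.
rewrite [X in _ = _ - X](_ : _ = \int[mu : probability (borel T) R]_x M).
  rewrite -RintegralB//.
- by apply: eq_Rintegral => x _; rewrite /g; field; lra.
- have := integrableZl measurableT (2 * M) ig; exact: eq_integrable.
- exact: finite_measure_integrable_cst.
- by rewrite Rintegral_cst// [X in fine X]probability_setT mulr1.
Qed.

(** Sums of squares are used instead of maxima of absolute values because they are polynomials in
    the integrals, with computable expectations. *)
Lemma weak_nbhs mu0 (W : set (borel_prob R T)) : nbhs mu0 W ->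
  exists (fs : seq unit_continuous) (r : R), 0 < r /\
    forall mu, \sum_(f <- fs) (unit_integral mu f - unit_integral mu0 f) ^+ 2 < r ->
      W mu.
Proof.
pose dist (fs : seq unit_continuous) mu :=
  \sum_(f <- fs) (unit_integral mu f - unit_integral mu0 f) ^+ 2.
have dist0 fs mu : 0 <= dist fs mu by apply: sumr_ge0 => f _; exact: sqr_ge0.
pose F := filter_from [set p : seq unit_continuous * R | 0 < p.2]
  (fun p => [set mu | dist p.1 mu < p.2]).
have FF : Filter F.
  apply: filter_from_filter; first by exists ([::], 1) => /=.
  move=> [s r] [s' r'] /= r0 r'0; exists (s ++ s', Num.min r r') => /=.
    by rewrite lt_min r0.
  move=> mu /=; rewrite /dist big_cat/= -/(dist s mu) -/(dist s' mu) lt_min.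
  by move=> /andP[h h']; split; apply: le_lt_trans; try exact: h; try exact: h';
    rewrite ?lerDl ?lerDr.
have FG : Filter (@integrals R T @ F) by exact: fmap_filter.
have Fmu : @integrals R T @ F --> integrals mu0.
  apply/cvg_sup => f A [B [[C oC <-] Cy] CA].
  have /nbhs_ballP[e /= e0 eC] : nbhs (integrals mu0 f) C by exact: open_nbhs_nbhs.
  have [[M g] /= M0 fg] := integrals_unit f.
  (* By [fg], a change of the integral of [g] by less than [e / (2 M)] changes that of [f] by less
     than [e]. *)
  exists ([:: g], (e / (2 * M)) ^+ 2) => /=.
    by rewrite exprn_gt0// divr_gt0// mulr_gt0.
  move=> mu /=; rewrite /dist big_seq1 => h; apply: CA; apply: eC.
  rewrite /ball/= !fg [X in `|X|](_ : _ =
    2 * M * (unit_integral mu0 g - unit_integral mu g)); last by ring.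
  rewrite normrM gtr0_norm ?mulr_gt0// mulrC -ltr_pdivlMr ?mulr_gt0//.
  rewrite -(@ltr_pXn2r _ 2)//= ?nnegrE ?normr_ge0 ?divr_ge0 ?mulr_ge0 ?ltW//.
  by rewrite distrC -normrX ger0_norm// sqr_ge0.
move=> [B [[C oC <-] Cmu] CW].
have /Fmu [[fs r] /= r0 h] : nbhs (integrals mu0) C by exact: open_nbhs_nbhs.
by exists fs, r; split=> // mu /h Cmu'; exact: CW.
Qed.

Lemma integral_empirical (n : nat) (z : 'I_n.+1 -> T) (f : T -> R) :
  continuous f -> unit_valued f ->
  \int[empirical R z : probability (borel T) R]_x f x =
  n.+1%:R^-1 * \sum_i f (z i).
Proof.
move=> cf f01; have mf := continuous_borel_real cf.
have mEf : measurable_fun [set: borel T] (EFin \o f) by exact/measurable_EFinP.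
have f0 x : (0 <= (f x)%:E)%E by rewrite lee_fin; case/andP: (f01 x).
have n0 : (0 <= n.+1%:R^-1 :> R)%R by rewrite invr_ge0 ler0n.
pose m (k : nat) : {measure set (borel T) -> \bar R} := \d_(z (inord k) : borel T).
rewrite /Rintegral.
rewrite (@eq_measure_integral _ _ _ _ (mscale (NngNum n0) (msum m n.+1))).
  rewrite ge0_integral_mscale//= ge0_integral_measure_sum//.
  rewrite (eq_bigr (fun i : 'I_n.+1 => (f (z i))%:E)) => [|i _].
    by rewrite sumEFin.
  by rewrite /m integral_dirac// diracT mul1e inord_val.
move=> A mA _; rewrite /mscale /msum/= /empirical_fun.
by congr (_ * _)%E; apply: eq_bigr => j _; rewrite /m inord_val.
Qed.

End weak_topology.

Lemma unit_prod (R : realType) (U : Type) (I : finType) (p : pred I)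
    (f : I -> U -> R) :
  (forall i, unit_valued (f i)) -> unit_valued (fun x => \prod_(i | p i) f i x).
Proof.
move=> f01 x; rewrite prodr_ge0/=; last by move=> i _; case/andP: (f01 i x).
by rewrite prodr_ile1// => i _; case/andP: (f01 i x) => -> ->.
Qed.

Lemma unit_mul (R : realType) (U : Type) (f g : U -> R) :
  unit_valued f -> unit_valued g -> unit_valued (fun x => f x * g x).
Proof.
move=> f01 g01 x; have /andP[f0 f1] := f01 x; have /andP[g0 g1] := g01 x.
by rewrite mulr_ge0//= mulr_ile1.
Qed.

Lemma unit_indic (R : realType) (U : Type) (A : set U) :
  unit_valued (\1_A : U -> R).
Proof. by move=> x; rewrite indicE ler0n lern1 leq_b1. Qed.

Lemma measurable_prod_cond d (Om : measurableType d) (R : realType)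
    (I : finType) (p : pred I) (h : I -> Om -> R) :
  (forall i, measurable_fun [set: Om] (h i)) ->
  measurable_fun [set: Om] (fun w => \prod_(i | p i) h i w).
Proof.
move=> mh; rewrite (_ : (fun _ => _) =
    fun w => \prod_i (if p i then h i w else 1)).
  by apply: measurable_prod => i _; case: (p i).
by apply/funext => w; rewrite big_mkcond.
Qed.

Lemma indic_bigcap (R : realType) (U : Type) (J : finType) (B : J -> set U) x :
  \1_(\bigcap_i B i) x = \prod_i \1_(B i) x :> R.
Proof.
have [/= h|/= h] := pselect (forall i, B i x).
  rewrite indicE mem_set; last by move=> i _; exact: h.
  by rewrite big1// => i _; rewrite indicE mem_set.
have /existsNP[i ni] := h.
rewrite (bigD1 i)//= [X in _ = X * _]indicE memNset// mul0r indicE memNset//.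
by move=> /(_ i I).
Qed.

Lemma measurable_Rintegral_kernel d d' (Om : measurableType d)
    (T : measurableType d') (R : realType) (k : Om -> probability T R)
    (f : T -> R) :
  (forall B, measurable B -> measurable_fun [set: Om] (fun w => k w B)) ->
  measurable_fun [set: T] f -> unit_valued f ->
  measurable_fun [set: Om] (fun w => \int[k w]_x f x).
Proof.
move=> mk mf f01; apply: measurableT_comp => //.
apply: (@measurable_fun_integral_kernel _ _ _ _ _ (fun w => k w)) => //.
- by move=> z; rewrite lee_fin; case/andP: (f01 z).
- exact/measurable_EFinP.
Qed.

Lemma integral_preimage d (Om : measurableType d) (R : realType)
    (P : probability Om R) (S : Type) (X : Om -> S) (A : set S) (g : Om -> R) :
  (\int[P]_(w in X @^-1` A) (g w)%:E = \int[P]_w (\1_A (X w) * g w)%:E)%E.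
Proof.
rewrite integral_mkcond; apply: eq_integral => w _; rewrite patchE indicE.
have -> : (w \in X @^-1` A) = (X w \in A) by apply/idP/idP; rewrite !inE.
by case: ifP => _; rewrite ?mul1r ?mul0r.
Qed.

Lemma probability_preimage d (Om : measurableType d) (R : realType)
    (P : probability Om R) (S : Type) (X : Om -> S) (A : set S) (E : set Om) :
  measurable E -> measurable (X @^-1` A) ->
  P (E `&` X @^-1` A) = (\int[P]_w (\1_A (X w) * \1_E w)%:E)%E.
Proof.
move=> mE mXA; rewrite -[X in P X]setIT -integral_indic//; last exact: measurableI.
by apply: eq_integral => w _; rewrite indicI/= mulrC.
Qed.

(** * Conditional independence as a product formula for functions *)

Section conditioning.
Context (R : realType) d (Om : measurableType d) (P : probability Om R)
  (S T : ptopologicalType) (X : Om -> S).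
Hypothesis rX : random_element X.

Lemma cond_prob_indic (E : set Om) (g : Om -> R) (A : set (borel S)) :
  measurable A -> is_cond_prob P X E g ->
  is_cond_prob P X (E `&` X @^-1` A) (fun w => \1_A (X w) * g w).
Proof.
move=> mA [mg Eg]; split.
  apply: measurable_funM => //.
  have mX : measurable_fun setT (X : g_sigma_algebra_preimageType
      (X : Om -> borel S) -> borel S) by move=> _ C mC; exists C.
  have mi : measurable_fun [set: borel S] (\1_A : borel S -> R).
    exact: measurable_indic.
  exact: measurableT_comp mi mX.
move=> B mB.
have mg' := preimage_measurable_fun rX mg.
have mAB : measurable (A `&` B) by exact: measurableI.
rewrite -setIA -preimage_setI -Eg// !integral_preimage.
by apply: eq_integral => w _; rewrite indicI/= mulrCA mulrA.
Qed.

Lemma cond_law_measurable (Z : Om -> T) (eta : Om -> borel_prob R T) :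
  is_cond_law P X Z eta -> forall B : set (borel T), measurable B ->
  measurable_fun [set: Om] (fun w => (eta w : probability (borel T) R) B).
Proof.
move=> cl B mB; have [/(preimage_measurable_fun rX)/measurable_EFinP mf _] := cl B mB.
by apply: eq_measurable_fun mf => w _ /=; rewrite fineK// fin_num_measure.
Qed.

End conditioning.

Section conditional_product.
Context (R : realType) d (Om : measurableType d) (P : probability Om R)
  (S T : ptopologicalType) (X : Om -> S) (q : nat) (Y : 'I_q -> Om -> T)
  (eta : Om -> borel_prob R (S * T)%type)
  (beta : nat -> S -> R) (gamma : nat -> T -> R).
Hypotheses (rX : random_element X) (rY : forall j, random_element (Y j))
  (bbeta : bump_sequence beta) (bgamma : bump_sequence gamma)
  (etaE : forall j, is_cond_law P X (fun w => (X w, Y j w)) eta)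
  (etam : forall B : set (borel (S * T)%type), measurable B ->
    measurable_fun [set: Om] (fun w => (eta w : probability _ R) B)).

Let rV j : random_element (fun w => (X w, Y j w)).
Proof. exact: (random_element_pair bbeta bgamma). Qed.

Let mrect (A : set (borel S)) (C : set (borel T)) :
  measurable A -> measurable C -> @measurable _ (borel (S * T)%type) (A `*` C).
Proof.
by move=> mA mC; apply: borel_rect_measurable; exists A => //; exists C.
Qed.

(** Both sides are versions of the conditional probability given X that X is in [A] and Y_j in [C].
    In other words, the first marginal of [eta] is almost surely the Dirac mass at [X], up to a null
    set depending on the rectangle. *)
Lemma cond_law_fst (j : 'I_q) (A : set (borel S)) (C : set (borel T)) :
  measurable A -> measurable C ->
  {ae P, forall w, fine ((eta w : probability _ R) (A `*` C)) =
    \1_A (X w) * fine ((eta w : probability _ R) (setT `*` C))}.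
Proof.
move=> mA mC; have mAC := mrect mA mC; have mTC := mrect measurableT mC.
apply: (@cond_prob_unique _ _ _ P _ X rX ((fun w => (X w, Y j w)) @^-1` (A `*` C))).
- by rewrite -[_ @^-1` _]setTI; exact: rV.
- exact: etaE.
have -> : (fun w => (X w, Y j w)) @^-1` (A `*` C) =
    (fun w => (X w, Y j w)) @^-1` (setT `*` C) `&` X @^-1` A.
  by apply/seteqP; split => w /=; [case=> ? ?; split|case=> -[_ ?] ?; split].
exact: (cond_prob_indic rX mA (etaE j mTC)).
Qed.

Hypothesis ciY : cond_independent P X Y.

Let mV j (f : S * T -> R) : measurable_fun [set: borel (S * T)%type] f ->
  measurable_fun [set: Om] (fun w => f (X w, Y j w)).
Proof. by move=> mf; exact: measurableT_comp mf (rV j). Qed.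

Let meta (f : S * T -> R) :
  measurable_fun [set: borel (S * T)%type] f -> unit_valued f ->
  measurable_fun [set: Om] (fun w => \int[eta w : probability _ R]_x f x).
Proof. by move=> mf f01; exact: measurable_Rintegral_kernel. Qed.

Let ueta (f : S * T -> R) :
  measurable_fun [set: borel (S * T)%type] f -> unit_valued f ->
  unit_valued (fun w => \int[eta w : probability _ R]_x f x).
Proof. by move=> mf f01 w; exact: unit_Rintegral. Qed.

Let mX (u : S -> R) : measurable_fun [set: borel S] u ->
  measurable_fun [set: Om] (fun w => u (X w)).
Proof. by move=> mu; exact: measurableT_comp mu rX. Qed.

(** The first sides of the rectangles all constrain [X]; gathered in [A'], they leave events on the
    [Y j] alone, to which conditional independence applies. [cond_law_fst] then returns them to the
    measures [eta w]. *)
Let rect_case (A : set (borel S)) (f : 'I_q -> S * T -> R) :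
  measurable A -> (forall j, exists2 B, borel_rect B & f j = \1_B) ->
  (\int[P]_w (\1_A (X w) * \prod_j f j (X w, Y j w))%:E =
   \int[P]_w (\1_A (X w) * \prod_j \int[eta w : probability _ R]_x f j x)%:E)%E.
Proof.
move=> mA fr.
have /choice[F FP] j : exists AC : set (borel S) * set (borel T),
    [/\ measurable AC.1, measurable AC.2 & f j = \1_(AC.1 `*` AC.2)].
  by have [_ [A' mA' [C mC <-]] ->] := fr j; exists (A', C).
have m1 j : measurable (F j).1 by case: (FP j).
have m2 j : measurable (F j).2 by case: (FP j).
have fE j : f j = \1_((F j).1 `*` (F j).2) by case: (FP j).
pose g j w := fine ((eta w : probability _ R) (setT `*` (F j).2)).
pose A' := A `&` \bigcap_(j in [set: 'I_q]) (F j).1.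
have mA' : measurable A'.
  by apply: measurableI => //; apply: fin_bigcap_measurable.
have gE j : is_cond_prob P X (Y j @^-1` (F j).2) (g j).
  have := etaE j (mrect measurableT (m2 j)).
  congr (is_cond_prob _ _ _ _).
  by apply/seteqP; split => w /=; [case|].
have [mg /(_ _ mA') gE'] := ciY m2 gE.
have inA' w : \1_A' (X w) = \1_A (X w) * \prod_j \1_(F j).1 (X w) :> R.
  by rewrite /A' indicI/= indic_bigcap.
have mXA' : measurable (X @^-1` A').
  by rewrite -[_ @^-1` _]setTI; exact: rX.
have mY : measurable (\bigcap_(j in [set: 'I_q]) Y j @^-1` (F j).2).
  apply: fin_bigcap_measurable => // j _.
  by rewrite -[_ @^-1` _]setTI; exact: rY.
transitivity (P ((\bigcap_(j in [set: 'I_q]) Y j @^-1` (F j).2) `&` X @^-1` A')).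
  rewrite probability_preimage//; apply: eq_integral => w _; congr (_%:E).
  rewrite inA' -mulrA; congr (_ * _).
  rewrite indic_bigcap -big_split/=; apply: eq_bigr => j _.
  rewrite fE !indicE -[_ * _](natrM _ (_ : bool) (_ : bool)) mulnb.
  by congr (_%:R); congr nat_of_bool; apply/idP/andP; rewrite !inE.
rewrite -gE' integral_preimage.
have mB j := mrect (m1 j) (m2 j).
apply: ae_eq_integral => //.
- apply/measurable_EFinP; apply: measurable_funM.
    exact/mX/measurable_indic.
  exact: (preimage_measurable_fun rX mg).
- apply/measurable_EFinP; apply: measurable_funM.
    exact/mX/measurable_indic.
  apply: measurable_prod => j _; apply: meta; rewrite fE.
    exact: measurable_indic.
  exact: unit_indic.
have : {ae P, forall w, forall j,
    fine ((eta w : probability _ R) ((F j).1 `*` (F j).2)) =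
    \1_((F j).1) (X w) * g j w}.
  by apply: filter_forall => j; exact: cond_law_fst.
apply: filterS => w h _ /=; congr (_%:E).
rewrite inA' -mulrA; congr (_ * _); rewrite -big_split/=.
by apply: eq_bigr => j _; rewrite fE Rintegral_indic// h.
Qed.

(* Trade the rectangles for arbitrary functions one coordinate at a time. *)
Let indic_case (t : nat) (A : set (borel S)) (f : 'I_q -> S * T -> R) :
  measurable A ->
  (forall j, measurable_fun [set: borel (S * T)%type] (f j)) ->
  (forall j, unit_valued (f j)) ->
  (forall j : 'I_q, (t <= j)%N -> exists2 B, borel_rect B & f j = \1_B) ->
  (\int[P]_w (\1_A (X w) * \prod_j f j (X w, Y j w))%:E =
   \int[P]_w (\1_A (X w) * \prod_j \int[eta w : probability _ R]_x f j x)%:E)%E.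
Proof.
move=> mA; elim: t f => [|t IH] f mf f01 fr.
  by apply: rect_case => // j; exact: fr.
have [tq|qt] := ltnP t q; last first.
  apply: IH => // j tj; move: (ltn_ord j).
  by rewrite ltnNge (leq_trans qt tj).
pose j0 := Ordinal tq.
(* All factors except the one at [j0] are frozen into weights, so the induction hypothesis, with a
   rectangle at [j0], is the pi-system identity required by [dirac_mixture_unique]. *)
pose W1 w := \1_A (X w) * \prod_(j | j != j0) f j (X w, Y j w).
pose W2 w := \1_A (X w) *
  \prod_(j | j != j0) \int[eta w : probability _ R]_x f j x.
have mW1 : measurable_fun setT W1.
  apply: measurable_funM; first exact/mX/measurable_indic.
  by apply: measurable_prod_cond => j; exact: mV.
have mW2 : measurable_fun setT W2.
  apply: measurable_funM; first exact/mX/measurable_indic.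
  by apply: measurable_prod_cond => j; exact: meta.
have W101 : unit_valued W1.
  apply: unit_mul; first by move=> w; exact: unit_indic.
  by apply: unit_prod => j w; exact: f01.
have W201 : unit_valued W2.
  apply: unit_mul; first by move=> w; exact: unit_indic.
  by apply: unit_prod => j; exact: ueta.
have E1 h w : W1 w * h (X w, Y j0 w) =
    \1_A (X w) * \prod_j (if j == j0 then h else f j) (X w, Y j w).
  rewrite /W1 [in RHS](bigD1 j0)//= eqxx -mulrA; congr (_ * _); rewrite mulrC.
  by congr (_ * _); apply: eq_bigr => j /negbTE ->.
have E2 h w : W2 w * \int[eta w : probability _ R]_x h x = \1_A (X w) *
    \prod_j \int[eta w : probability _ R]_x (if j == j0 then h else f j) x.
  rewrite /W2 [in RHS](bigD1 j0)//= eqxx -mulrA; congr (_ * _); rewrite mulrC.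
  by congr (_ * _); apply: eq_bigr => j /negbTE ->.
transitivity (\int[P]_w (W1 w * f j0 (X w, Y j0 w))%:E)%E.
  apply: eq_integral => w _; rewrite E1; congr ((_ * _)%:E).
  by apply: eq_bigr => j _; case: eqP => // ->.
transitivity (\int[P]_w (W2 w * \int[eta w : probability _ R]_x f j0 x)%:E)%E;
  last first.
  apply: eq_integral => w _; rewrite E2; congr ((_ * _)%:E).
  by apply: eq_bigr => j _; case: eqP => // ->.
apply: (dirac_mixture_unique (T := borel (S * T)%type)
  (V := fun w => (X w, Y j0 w)) (G := @borel_rect S T)) => //.
- exact: rV.
- exact: (borel_prodE bbeta bgamma).
- exact: borel_rect_setI.
- exact: borel_rectT.
move=> B rB; have mB := borel_rect_measurable rB.
under eq_integral do rewrite E1; under [in RHS]eq_integral do rewrite E2.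
apply: IH => [j|j|j tj]; first by case: ifP => // _; exact: measurable_indic.
  by case: ifP => // _; exact: unit_indic.
case: eqVneq => [_|jj0]; first by exists B.
apply: fr; rewrite ltn_neqAle tj andbT.
by apply: contra jj0 => /eqP tj0; apply/eqP/val_inj.
Qed.

(** What remains is to replace the indicator of [X] in [A] by [u]; here the products serve as
    weights and [X] as the variable. *)
Lemma cond_independent_prod (u : S -> R) (f : 'I_q -> S * T -> R) :
  measurable_fun [set: borel S] u -> unit_valued u ->
  (forall j, measurable_fun [set: borel (S * T)%type] (f j)) ->
  (forall j, unit_valued (f j)) ->
  (\int[P]_w (u (X w) * \prod_j f j (X w, Y j w))%:E =
   \int[P]_w (u (X w) * \prod_j \int[eta w : probability _ R]_x f j x)%:E)%E.
Proof.
move=> mu u01 mf f01.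
have mW2 : measurable_fun setT
    (fun w => \prod_j \int[eta w : probability _ R]_x f j x).
  by apply: measurable_prod_cond => j; exact: meta.
under eq_integral do rewrite mulrC; under [in RHS]eq_integral do rewrite mulrC.
apply: (weighted_law_unique (T := borel S) (V1 := X) (V2 := X)) => //.
- by apply: measurable_prod_cond => j; exact: mV.
- by apply: unit_prod => j w; exact: f01.
- by apply: unit_prod => j; exact: ueta.
move=> A mA.
under eq_integral do rewrite mulrC; under [in RHS]eq_integral do rewrite mulrC.
by apply: (indic_case (t := q)) => // j; rewrite leqNgt ltn_ord.
Qed.

End conditional_product.

(** * Convergence of expectations by partitions of unity *)

(** [F] may be non-measurable: its expectation lies between the integrals of [S - g] and [S + g],
    which also shows that it is finite. *)
Lemma expectation_approx d (Om : measurableType d) (R : realType)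
    (P : probability Om R) (F S g : Om -> R) :
  P.-integrable setT (EFin \o S) -> P.-integrable setT (EFin \o g) ->
  {ae P, forall w, `|F w - S w| <= g w} ->
  'E_P[F]%E \is a fin_num /\ `|fine 'E_P[F]%E - \int[P]_w S w| <= \int[P]_w g w.
Proof.
move=> iS ig Fg; rewrite unlock.
have iSg : P.-integrable setT (EFin \o (fun w => S w + g w)).
  by have := integrableD measurableT iS ig; apply: eq_integrable.
have iSB : P.-integrable setT (EFin \o (fun w => S w - g w)).
  by have := integrableB measurableT iS ig; apply: eq_integrable.
have le1 : (\int[P]_w (S w - g w)%:E <= \int[P]_w (F w)%:E)%E.
  apply: ae_le_integral; apply: filterS Fg => w.
  by rewrite lee_fin ler_norml => /andP[]; lra.
have le2 : (\int[P]_w (F w)%:E <= \int[P]_w (S w + g w)%:E)%E.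
  apply: ae_le_integral; apply: filterS Fg => w.
  by rewrite lee_fin ler_norml => /andP[]; lra.
have f1 := integrable_fin_num measurableT iSB.
have f2 := integrable_fin_num measurableT iSg.
have fF : (\int[P]_w (F w)%:E)%E \is a fin_num.
  rewrite fin_numE; apply/andP; split; apply/negP => /eqP FE.
    by move: le1 f1; rewrite FE leeNy_eq => /eqP /= ->.
  by move: le2 f2; rewrite FE leye_eq => /eqP /= ->.
split => //.
have := fine_le f1 fF le1; have := fine_le fF f2 le2.
rewrite -/(Rintegral P setT (fun w => S w + g w)).
rewrite -/(Rintegral P setT (fun w => S w - g w)).
rewrite RintegralD// RintegralB// ler_norml => h1 h2.
by apply/andP; split; lra.
Qed.

Section bump_partition.
Context (R : realType) (U : Type) (b : nat -> U -> R).

(** The analogue for functions of making a sequence of sets disjoint: [b l] acts on what the earlier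
    bumps leave over. *)
Definition bump_part (l : nat) (x : U) : R := b l x * \prod_(i < l) (1 - b i x).

Lemma sum_bump_part m x :
  \sum_(l < m) bump_part l x = 1 - \prod_(i < m) (1 - b i x).
Proof.
elim: m => [|m IH]; first by rewrite !big_ord0 subrr.
by rewrite !big_ord_recr/= IH /bump_part; ring.
Qed.

Hypothesis b01 : forall l, unit_valued (b l).

Lemma unit_onem l : unit_valued (fun x => 1 - b l x).
Proof. by move=> x; have := b01 l x; lra. Qed.

Lemma bump_part_unit l : unit_valued (bump_part l).
Proof.
apply: unit_mul => //.
exact: (@unit_prod _ _ _ xpredT (fun (i : 'I_l) x => 1 - b i x)) (fun i => @unit_onem i).
Qed.

(** The local bounds carry the factor [b l x], so they say nothing off the support of the bump. The
    mass missed by the first [m] parts is charged at the uniform bound [M]. *)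
Lemma bump_part_approx (F M e : R) (c r : nat -> R) m x :
  `|F| <= M -> (forall l, b l x * `|F - c l| <= b l x * (e + r l)) ->
  `|F - \sum_(l < m) bump_part l x * c l| <=
  \sum_(l < m) bump_part l x * (e + r l) + M * (1 - \sum_(l < m) bump_part l x).
Proof.
move=> FM Fc.
have -> : F - \sum_(l < m) bump_part l x * c l =
    \sum_(l < m) bump_part l x * (F - c l) + (1 - \sum_(l < m) bump_part l x) * F.
  under [X in _ = X + _]eq_bigr do rewrite mulrBr.
  by rewrite big_split/= sumrN -mulr_suml; ring.
rewrite (le_trans (ler_normD _ _))// lerD//.
  rewrite (le_trans (ler_norm_sum _ _ _))// ler_sum// => l _.
  have /andP[p0 _] := bump_part_unit l x.
  rewrite normrM (ger0_norm p0) /bump_part [leLHS]mulrAC [leRHS]mulrAC ler_wpM2r//.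
  by have /andP[] := @unit_prod _ _ _ xpredT _ (fun i : 'I_l => @unit_onem i) x.
have s0 : 0 <= 1 - \sum_(l < m) bump_part l x.
  rewrite sum_bump_part subKr.
  by have /andP[] := @unit_prod _ _ _ xpredT _ (fun i : 'I_m => @unit_onem i) x.
by rewrite normrM (ger0_norm s0) mulrC ler_wpM2r.
Qed.

End bump_partition.

Lemma bounded_integrable d (Om : measurableType d) (R : realType)
    (P : probability Om R) (f : Om -> R) (B : R) :
  measurable_fun [set: Om] f -> (forall w, `|f w| <= B) ->
  P.-integrable setT (EFin \o f).
Proof.
move=> mf fB; apply: measurable_bounded_integrable => //.
  by rewrite (le_lt_trans (probability_le1 _ _))// ltry.
by exists B; split; [exact: num_real|move=> M BM x _ /=; rewrite (le_trans (fB x))// ltW].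
Qed.

Lemma ae_le_Rintegral d (Om : measurableType d) (R : realType)
    (P : probability Om R) (f g : Om -> R) :
  P.-integrable setT (EFin \o f) -> P.-integrable setT (EFin \o g) ->
  {ae P, forall w, f w <= g w} -> \int[P]_w f w <= \int[P]_w g w.
Proof.
move=> fi gi fg; apply: fine_le; [exact: integrable_fin_num|
  exact: integrable_fin_num|].
by apply: ae_le_integral; apply: filterS fg => w; rewrite lee_fin.
Qed.

Lemma Rintegral_sum d (Om : measurableType d) (R : realType)
    (P : probability Om R) (I : Type) (s : seq I) (f : I -> Om -> R) :
  (forall i, P.-integrable setT (EFin \o f i)) ->
  \int[P]_w (\sum_(i <- s) f i w) = \sum_(i <- s) \int[P]_w f i w.
Proof.
move=> fi; elim: s => [|i s IH].
  rewrite big_nil (_ : (fun _ => _) = cst 0); first by rewrite Rintegral_cst// mul0r.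
  by apply/funext => w; rewrite big_nil.
rewrite big_cons -IH -RintegralD//; last first.
  have := integrable_sum measurableT s (P := xpredT) (fun i _ => fi i).
  by apply: eq_integrable => // w _ /=; rewrite -sumEFin.
by congr (Rintegral _ _ _); apply/funext => w; rewrite big_cons.
Qed.

Lemma measurable_bump_part d (Om : measurableType d) (R : realType)
    (b : nat -> Om -> R) l :
  (forall l, measurable_fun [set: Om] (b l)) ->
  measurable_fun [set: Om] (bump_part b l).
Proof.
move=> mb; apply: measurable_funM => //.
apply: (@measurable_prod_cond _ _ _ _ xpredT (fun (i : 'I_l) w => 1 - b i w)) => i.
by apply: measurable_funB.
Qed.

(** The remainder is the product of the [1 - b i], which vanishes as soon as a bump equal to 1 has
    occurred; dominated convergence applies. *)
Lemma bump_rest_small d (Om : measurableType d) (R : realType)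
    (P : probability Om R) (b : nat -> Om -> R) (e : R) :
  (forall l, measurable_fun [set: Om] (b l)) -> (forall l, unit_valued (b l)) ->
  {ae P, forall w, exists l, b l w = 1} -> 0 < e ->
  exists m, 1 - \sum_(l < m) \int[P]_w bump_part b l w < e.
Proof.
move=> mb b01 b1 e0.
pose r m w := \prod_(i < m) (1 - b i w).
have r01 m : unit_valued (r m).
  exact: (@unit_prod _ _ _ xpredT _ (fun i : 'I_m => @unit_onem _ _ _ b01 i)).
have mr m : measurable_fun setT (r m).
  apply: (@measurable_prod_cond _ _ _ _ xpredT (fun (i : 'I_m) w => 1 - b i w)).
  by move=> i; exact: measurable_funB.
have rE m : 1 - \sum_(l < m) \int[P]_w bump_part b l w = \int[P]_w r m w.
  have ip l : P.-integrable setT (EFin \o bump_part b l).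
    by apply: unit_integrable; [exact: measurable_bump_part|exact: bump_part_unit].
  rewrite -Rintegral_sum//.
  have -> : 1 = \int[P]_w (1 : R) :> R.
    by rewrite Rintegral_cst// [X in fine X]probability_setT mul1r.
  rewrite -RintegralB//; last 2 first.
  - by apply: (@bounded_integrable _ _ _ _ _ 1) => // w; rewrite normr1.
  - have := integrable_sum measurableT (index_enum 'I_m) (P := xpredT)
      (fun (i : 'I_m) _ => ip i).
    by apply: eq_integrable => // w _ /=; rewrite -sumEFin.
  congr (Rintegral _ _ _); apply/funext => w.
  by rewrite sum_bump_part subKr.
have r0 : {ae P, forall w, setT w -> (r m w)%:E @[m --> \oo] --> (0 : R)%:E}.
  apply: filterS b1 => w [l bl] _; apply: (@cvg_near_cst _ _ (0%:E)).
  near=> m; rewrite /r; congr (_%:E); apply/eqP/prodf_eq0.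
  have lm : (l < m)%N by near: m; exact: nbhs_infty_gt.
  by exists (Ordinal lm) => //=; rewrite bl subrr.
have H : {ae P, forall w m, setT w -> (`|(r m w)%:E| <= (cst 1%:E) w)%E}.
  apply: aeW => w m _.
  by rewrite lee_fin; have /andP[r0' r1] := r01 m w; rewrite ger0_norm.
have [_ _] := @dominated_convergence _ _ _ P setT measurableT
  (fun m w => (r m w)%:E) (fun=> 0%:E) (cst 1%:E)
  (fun m => proj2 (measurable_EFinP _ _) (mr m)) (measurable_cst _) r0
  (finite_measure_integrable_cst P 1 measurableT) H.
rewrite integral0 => /fine_cvg/cvgrPdist_lt/(_ _ e0) [m _ /(_ m (leqnn m))].
rewrite sub0r normrN => h; exists m; rewrite rE.
by rewrite (le_lt_trans (ler_norm _)).
Unshelve. all: by end_near. Qed.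

Lemma cvg_sumr (R : realType) (I T : Type) (F : set_system T) (s : seq I)
    (f : I -> T -> R) (a : I -> R) :
  Filter F -> (forall i, f i x @[x --> F] --> a i) ->
  \sum_(i <- s) f i x @[x --> F] --> \sum_(i <- s) a i.
Proof. by move=> FF fa; apply: cvg_big => //; exact: add_continuous. Qed.

Lemma expectation_bump_part d (Om : measurableType d) (R : realType)
    (P : probability Om R) (F : Om -> R) (b r : nat -> Om -> R) (c B : nat -> R)
    (M e : R) (m : nat) :
  (forall w, `|F w| <= M) ->
  (forall l, measurable_fun [set: Om] (b l)) -> (forall l, unit_valued (b l)) ->
  (forall l, measurable_fun [set: Om] (r l)) -> (forall l w, `|r l w| <= B l) ->
  {ae P, forall w l, b l w * `|F w - c l| <= b l w * (e + r l w)} ->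
  'E_P[F]%E \is a fin_num /\
  `|fine 'E_P[F]%E - \sum_(l < m) \int[P]_w bump_part b l w * c l| <=
    \sum_(l < m) (e * (\int[P]_w bump_part b l w)
                  + \int[P]_w (bump_part b l w * r l w)) +
    M * (1 - \sum_(l < m) \int[P]_w bump_part b l w).
Proof.
move=> FM mb b01 mr rB Fr.
have mp l : measurable_fun setT (bump_part b l) by exact: measurable_bump_part.
have ip l : P.-integrable setT (EFin \o bump_part b l).
  by apply: unit_integrable => //; exact: bump_part_unit.
have ipc (k : R) l : P.-integrable setT (EFin \o (fun w => bump_part b l w * k)).
  have := integrableZr measurableT k (ip l); exact: eq_integrable.
have it l : P.-integrable setT (EFin \o (fun w => bump_part b l w * r l w)).
  apply: (@bounded_integrable _ _ _ _ _ (B l)); first exact: measurable_funM.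
  move=> w; have /andP[p0 p1] := bump_part_unit b01 l w.
  by rewrite normrM ger0_norm// -[leRHS]mul1r ler_pM.
have ier l : P.-integrable setT
    (EFin \o (fun w => bump_part b l w * (e + r l w))).
  have := integrableD measurableT (ipc e l) (it l).
  by apply: eq_integrable => // w _ /=; rewrite -EFinD mulrDr.
have isum (f : nat -> Om -> R) : (forall l, P.-integrable setT (EFin \o f l)) ->
    P.-integrable setT (EFin \o (fun w => \sum_(l < m) f l w)).
  move=> fi; have := integrable_sum measurableT (index_enum 'I_m) (P := xpredT)
    (fun (i : 'I_m) _ => fi i).
  by apply: eq_integrable => // w _ /=; rewrite -sumEFin.
have i1 : P.-integrable setT (EFin \o (fun=> 1 : R)).
  by apply: (@bounded_integrable _ _ _ _ _ 1) => // w; rewrite normr1.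
have irest : P.-integrable setT
    (EFin \o (fun w => 1 - \sum_(l < m) bump_part b l w)).
  have := integrableB measurableT i1 (isum _ ip).
  by apply: eq_integrable.
have iMrest : P.-integrable setT
    (EFin \o (fun w => M * (1 - \sum_(l < m) bump_part b l w))).
  have := integrableZl measurableT M irest; exact: eq_integrable.
have [||fE] := @expectation_approx _ _ _ P F
  (fun w => \sum_(l < m) bump_part b l w * c l)
  (fun w => \sum_(l < m) bump_part b l w * (e + r l w) +
    M * (1 - \sum_(l < m) bump_part b l w))
  (isum (fun l w => bump_part b l w * c l) (fun l => ipc _ l)) _ _.
- have := integrableD measurableT (isum _ ier) iMrest; exact: eq_integrable.
- apply: filterS Fr => w Fr.
  exact: (@bump_part_approx _ _ b b01 _ M e c (fun l => r l w)).
rewrite (Rintegral_sum _ (fun l : 'I_m => ipc (c l) l)).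
rewrite RintegralD//; last exact: (isum (fun l w => bump_part b l w * (e + r l w))).
rewrite (Rintegral_sum _ (fun l : 'I_m => ier l)) RintegralZl// RintegralB//;
  last exact: (isum (bump_part b)).
rewrite (Rintegral_sum _ (fun l : 'I_m => ip l)) Rintegral_cst//.
rewrite [X in 1 * fine X]probability_setT mul1r.
under [X in `|_ - X| <= _]eq_bigr do rewrite RintegralZr//.
under [X in _ <= X + _]eq_bigr => l _.
  under eq_Rintegral do rewrite mulrDr.
  rewrite RintegralD// RintegralZr// mulrC.
  over.
by [].
Qed.

(** Both implications of the theorem end here. The two expectations are compared with the same
    combination of the constants [c l], weighted by the masses of the parts. The random error [r]
    serves functions that also depend on a measure: it is not small pointwise, only its integral
    against each part has a small limit. *)
Lemma cvg_expectation_bumps (R : realType) (d : nat -> measure_display)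
    (Om : forall n, measurableType (d n)) (P : forall n, probability (Om n) R)
    d' (Om' : measurableType d') (P' : probability Om' R)
    (F : forall n, Om n -> R) (F' : Om' -> R) (M : R) :
  (forall n w, `|F n w| <= M) -> (forall w, `|F' w| <= M) ->
  (forall e : R, 0 < e -> exists (b : forall n, nat -> Om n -> R)
      (r : forall n, nat -> Om n -> R) (b' : nat -> Om' -> R) (c B : nat -> R),
    [/\ [/\ (forall n l, measurable_fun [set: Om n] (b n l)),
            (forall n l, unit_valued (b n l)),
            (forall l, measurable_fun [set: Om'] (b' l)) &
            (forall l, unit_valued (b' l))],
        [/\ (forall n l, measurable_fun [set: Om n] (r n l)),
            (forall n l w, `|r n l w| <= B l) &
            (forall n w l, b n l w * `|F n w - c l| <= b n l w * (e + r n l w))],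
        {ae P', forall w l, b' l w * `|F' w - c l| <= b' l w * e},
        {ae P', forall w, exists l, b' l w = 1} &
        (forall l, \int[P n]_w bump_part (b n) l w @[n --> \oo] -->
            \int[P']_w bump_part b' l w) /\
        (forall l, exists2 L, L <= e * \int[P']_w bump_part b' l w &
            \int[P n]_w (bump_part (b n) l w * r n l w) @[n --> \oo] --> L)]) ->
  'E_(P n)[F n]%E @[n --> \oo] --> 'E_P'[F']%E.
Proof.
move=> FM F'M H.
have M0 : 0 <= M := le_trans (normr_ge0 _) (F'M point).
(* The constant is made of [3 + M] for the error at [n], [1 + M] for the error at the limit, and 1
   for the distance between the two finite sums. *)
have approx (e : R) : 0 < e -> [/\ 'E_P'[F']%E \is a fin_num,
    (forall n, 'E_(P n)[F n]%E \is a fin_num) &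
    \forall n \near \oo, `|fine 'E_(P n)[F n]%E - fine 'E_P'[F']%E| < (5 + 2 * M) * e].
  move=> e0; have [b [r [b' [c [B]]]]] := H _ e0.
  move=> [[mb b01 mb' b'01] [mr rB Fr] F'r b'1 [cb cr]].
  have [m hm] := bump_rest_small mb' b'01 b'1 e0.
  pose p n l := \int[P n]_w bump_part (b n) l w.
  pose p' l := \int[P']_w bump_part b' l w.
  pose t n l := \int[P n]_w (bump_part (b n) l w * r n l w).
  have [L Le tL] : exists2 L, (forall l, L l <= e * p' l) &
      forall l, t n l @[n --> \oo] --> L l.
    have /choice[L HL] l : exists L, L <= e * p' l /\ t n l @[n --> \oo] --> L.
      by have [L ? ?] := cr l; exists L.
    by exists L => l; case: (HL l).
  have main n := @expectation_bump_part _ _ _ (P n) (F n) (b n) (r n) c B M e m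
    (FM n) (mb n) (b01 n) (mr n) (rB n) (aeW _ (Fr n)).
  have main' : 'E_P'[F']%E \is a fin_num /\
    `|fine 'E_P'[F']%E - \sum_(l < m) p' l * c l| <=
      \sum_(l < m) (e * p' l) + M * (1 - \sum_(l < m) p' l).
    have [||fE'] := @expectation_bump_part _ _ _ P' F' b' (fun=> cst 0) c
      (fun=> 0) M e m F'M mb' b'01 (fun=> measurable_cst _).
    - by move=> l w; rewrite normr0.
    - by apply: filterS F'r => w h l; rewrite addr0.
    under [X in _ <= X + _]eq_bigr => l _.
      under [X in _ + X]eq_Rintegral do rewrite mulr0.
      rewrite Rintegral_cst// mul0r addr0.
      over.
    by [].
  have sum1 : \sum_(l < m) p' l <= 1.
    have ip' l : P'.-integrable setT (EFin \o bump_part b' l).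
      by apply: unit_integrable; [exact: measurable_bump_part|exact: bump_part_unit].
    rewrite /p' -(Rintegral_sum _ (fun l : 'I_m => ip' l)).
    have mS : measurable_fun setT (fun w => \sum_(l < m) bump_part b' l w).
      by apply: measurable_sum => l; exact: measurable_bump_part.
    have S01 : unit_valued (fun w => \sum_(l < m) bump_part b' l w).
      move=> w; rewrite sum_bump_part.
      have := @unit_prod _ _ _ xpredT _ (fun i : 'I_m => @unit_onem _ _ _ b'01 i) w.
      by lra.
    by have /andP[] := unit_Rintegral P' mS S01.
  split; [by case: main'|by move=> n; case: (main n)|].
  have c1 : (\sum_(l < m) (e * p n l + t n l) + M * (1 - \sum_(l < m) p n l))
      @[n --> \oo] -->
      \sum_(l < m) (e * p' l + L l) + M * (1 - \sum_(l < m) p' l).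
    apply: cvgD; last first.
      apply: cvgMr; apply: cvgB; first exact: cvg_cst.
      by apply: cvg_sumr => l; exact: cb.
    apply: cvg_sumr => l; apply: cvgD => //.
    by apply: cvgMr; exact: cb.
  have c2 : (\sum_(l < m) p n l * c l) @[n --> \oo] --> \sum_(l < m) p' l * c l.
    by apply: cvg_sumr => l; apply: cvgMl; exact: cb.
  have b1 : \sum_(l < m) (e * p' l + L l) + M * (1 - \sum_(l < m) p' l) <=
      (2 + M) * e.
    have : \sum_(l < m) (e * p' l + L l) <= 2 * e.
      rewrite (@le_trans _ _ (\sum_(l < m) 2 * e * p' l))//.
        by apply: ler_sum => l _; have := Le l; lra.
      rewrite -mulr_sumr; nra.
    have := hm; rewrite -/p' => hm'; nra.
  have b2 : \sum_(l < m) (e * p' l) + M * (1 - \sum_(l < m) p' l) <= (1 + M) * e.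
    by rewrite -mulr_sumr; have := hm; rewrite -/p' => hm'; nra.
  near=> n.
  have h1 : \sum_(l < m) (e * p n l + t n l) + M * (1 - \sum_(l < m) p n l) <
      (3 + M) * e.
    near: n; move/cvgrPdist_lt : c1 => /(_ _ e0); apply: filterS => n.
    by rewrite ltr_norml => /andP[]; lra.
  have h2 : `|\sum_(l < m) p' l * c l - \sum_(l < m) p n l * c l| < e.
    by near: n; move/cvgrPdist_lt : c2 => /(_ _ e0).
  have [_ h3] := main n; have [_ h4] := main'.
  move: h2 h3 h4; rewrite ltr_norml !ler_norml ltr_norml.
  by move=> /andP[? ?] /andP[? ?] /andP[? ?]; apply/andP; split; lra.
have [fE' fE _] := approx 1 ltr01.
rewrite -(fineK fE') (_ : (fun n => _) = (fun n => (fine 'E_(P n)[F n]%E)%:E)); last first.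
  by apply/funext => n; rewrite fineK.
apply: cvg_EFin; first exact: nearW.
apply/cvgrPdist_lt => e e0.
have e'0 : 0 < e / (5 + 2 * M) by rewrite divr_gt0//; lra.
have [_ _] := approx _ e'0; apply: filterS => n.
by rewrite distrC mulrCA divff ?mulr1//; lra.
Unshelve. all: by end_near. Qed.

(** * Exchangeability and averages over index maps *)

(** Induction along a list of arguments: a transposition corrects the value at the new argument and,
    by injectivity, moves none of the values already fixed. *)
Lemma perm_extension (D T : finType) (f g : D -> T) :
  injective f -> injective g -> exists s : {perm T}, forall x, s (f x) = g x.
Proof.
move=> fI gI.
suff H (l : seq D) : uniq l -> exists s : {perm T}, {in l, forall x, s (f x) = g x}.
  by have [s sE] := H _ (enum_uniq D); exists s => x; apply: sE; rewrite mem_enum.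
elim: l => [|x l IH] /=; first by exists 1%g.
move=> /andP[xl /IH[s sE]]; exists (s * tperm (s (f x)) (g x))%g => y.
rewrite inE permM => /predU1P[->|yl]; first by rewrite tpermL.
have yx : x != y by apply: contraNneq xl => ->.
rewrite (sE y yl) tpermD//.
- by rewrite -(sE y yl); apply: contraNneq yx => /perm_inj/fI ->.
- by apply: contraNneq yx => /gI ->.
Qed.

Lemma continuous_preimage_borel (R : realType) (T : topologicalType)
    (G : T -> R) (B : set R) : continuous G -> measurable B ->
  <<s @open T >> (G @^-1` B).
Proof.
move=> /continuousP cG mB; rewrite -[_ @^-1` _]setTI.
suff : <<s @RGenOInfty.G R >> `<=` image_set_system setT G <<s @open T >>.
  have mB' : (@RGenOInfty.G R).-sigma.-measurable B by rewrite -RGenOInfty.measurableE.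
  exact.
apply: smallest_sub; first exact/sigma_algebra_image/smallest_sigma_algebra.
move=> _ [x ->]; rewrite /image_set_system/= setTI; apply: sub_sigma_algebra.
by apply: cG; rewrite set_itvE; exact: open_gt.
Qed.

(** Only the real variables obtained through [G] are assumed measurable, not [V] and [V']
    themselves, so the comparison is made between laws on the real line. *)
Lemma same_law_expectation (R : realType) (T : topologicalType)
    d (Om : measurableType d) (P : probability Om R) (V V' : Om -> T)
    (G : T -> R) :
  same_law P V P V' -> continuous G -> unit_valued G ->
  measurable_fun [set: Om] (G \o V) -> measurable_fun [set: Om] (G \o V') ->
  \int[P]_w G (V w) = \int[P]_w G (V' w).
Proof.
move=> VV' cG G01 mGV mGV'.
(* The identity cut off outside [0, 1]: [unit_valued] on the whole line, without effect on the
   values of [G]. *)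
pose f (y : R) := \1_`[0, 1] y * y.
have fG z : f (G z) = G z.
  by rewrite /f indicE mem_set ?mul1r//= in_itv/=; exact: G01.
have mf : measurable_fun [set: R] f.
  by apply: measurable_funM => //; exact: measurable_indic.
have f01 : unit_valued f.
  move=> y; rewrite /f indicE; have [|] := boolP (y \in _); last by rewrite mul0r lexx ler01.
  by rewrite inE/= in_itv/= mul1r.
have one01 : unit_valued (cst 1 : Om -> R) by move=> w; rewrite /= ler01 lexx.
have fE V0 : \int[P]_w G (V0 w) = fine (\int[P]_w (cst 1 w * f (G (V0 w)))%:E)%E.
  by congr fine; apply: eq_integral => w _; rewrite mul1r fG.
rewrite !fE; congr fine.
apply: (weighted_law_unique (V1 := G \o V) (V2 := G \o V')) => // B mB.
have pre V0 : measurable_fun [set: Om] (G \o V0) ->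
    (\int[P]_w (cst 1 w * \1_B (G (V0 w)))%:E = P (V0 @^-1` (G @^-1` B)))%E.
  move=> mGV0; under eq_integral do rewrite mul1r.
  rewrite -[X in _ = P X]setIT -integral_indic//.
  by have := mGV0 measurableT _ mB; rewrite setTI.
by rewrite !pre//; exact: VV' (continuous_preimage_borel cG mB).
Qed.

Lemma continuous_coord (R : realType) (S T : ptopologicalType) (I : choiceType)
    (h : S * T -> R) (i : I) : continuous h ->
  continuous (fun z : S * {ptws I -> T} => h (z.1, z.2 i)).
Proof.
move=> ch z; apply: (@continuous_comp _ _ _
  (fun z : S * {ptws I -> T} => (z.1, z.2 i)) h); last exact: ch.
apply: cvg_pair; first exact: cvg_fst.
apply: (@cvg_comp _ _ _ snd (proj i : {ptws I -> T} -> T) _ (nbhs z.2)).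
  exact: cvg_snd.
exact: (@proj_continuous I (fun=> T) i z.2).
Qed.

Section exchangeable_average.
Context (R : realType) d (Om : measurableType d) (P : probability Om R)
  (S T : ptopologicalType) (X : Om -> S) (q m : nat)
  (Y : 'I_(q + m).+1 -> Om -> T)
  (beta : nat -> S -> R) (gamma : nat -> T -> R).
Hypotheses (rX : random_element X) (rY : forall i, random_element (Y i))
  (bbeta : bump_sequence beta) (bgamma : bump_sequence gamma)
  (exch : exchangeable_excluding P X ord0 Y).
Variables (u : S -> R) (h : 'I_q -> S * T -> R).
Hypotheses (cu : continuous u) (u01 : unit_valued u)
  (ch : forall j, continuous (h j)) (h01 : forall j, unit_valued (h j)).

Let N := (q + m).+1.
Let first_entries (j : 'I_q) : 'I_N := lift ord0 (lshift m j).
Let G (phi : 'I_q -> 'I_N) w := u (X w) * \prod_j h j (X w, Y (phi j) w).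

Let mh i j : measurable_fun [set: Om] (fun w => h j (X w, Y i w)).
Proof.
exact: continuous_random_real (@ch j) (random_element_pair bbeta bgamma rX (rY i)).
Qed.

Let mu : measurable_fun [set: Om] (fun w => u (X w)).
Proof. exact: continuous_random_real cu rX. Qed.

Let mG phi : measurable_fun [set: Om] (G phi).
Proof. by apply: measurable_funM => //; exact: measurable_prod_cond. Qed.

Let G01 phi : unit_valued (G phi).
Proof.
apply: unit_mul; first by move=> w; exact: u01.
exact: (@unit_prod _ _ _ xpredT (fun j w => h j (X w, Y (phi j) w))
  (fun j w => h01 j _)).
Qed.

(** Entry 1, taken as the value at [None], extends both index maps to injections of [option 'I_q]. A
    permutation carrying one extension to the other fixes entry 1, as exchangeability requires. *)
Let EG_good (phi : 'I_q -> 'I_N) : injective phi -> (forall j, phi j != ord0) ->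
  \int[P]_w G phi w = \int[P]_w G first_entries w.
Proof.
move=> phiI phi0.
have [s sE] : exists s : {perm 'I_N}, forall x : option 'I_q,
    s (oapp first_entries ord0 x) = oapp phi ord0 x.
  apply: perm_extension => -[j|] [k|]//=.
  - by move=> /lift_inj/lshift_inj ->.
  - by move=> /phiI ->.
  - by move=> jk; have := phi0 j; rewrite jk eqxx.
  - by move=> jk; have := phi0 k; rewrite -jk eqxx.
have s0 : s ord0 = ord0 := sE None.
pose Gs (z : S * {ptws 'I_N -> T}) :=
  u z.1 * \prod_j h j (z.1, z.2 (first_entries j)).
have := same_law_expectation (G := Gs) (exch s0).
have GE w : Gs (X w, fun j => Y (s j) w) = G phi w.
  by congr (_ * _); apply: eq_bigr => j _ /=; rewrite (sE (Some j)).
rewrite (_ : (fun w => Gs (X w, fun j => Y (s j) w)) = G phi); last exact/funext.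
move=> ->//.
- move=> z; apply: cvgM.
    by apply: (@continuous_comp _ _ _ fst u); [exact: cvg_fst|exact: cu].
  apply: (@continuous_prod _ _ _ _ (fun j (z : S * {ptws 'I_N -> T}) =>
    h j (z.1, z.2 (first_entries j)))).
  by move=> j; exact: continuous_coord.
- apply: unit_mul; first by move=> z; exact: u01.
  exact: (@unit_prod _ _ _ xpredT
    (fun j (z : S * {ptws 'I_N -> T}) => h j (z.1, z.2 (first_entries j)))
    (fun j z => h01 j _)).
- exact: (mG first_entries).
- by rewrite (_ : _ \o _ = G phi)//; exact/funext.
Qed.

Let good : {set {ffun 'I_q -> 'I_N}} :=
  [set phi : {ffun 'I_q -> 'I_N} | injectiveb phi && [forall j, phi j != ord0]]%SET.

Let card_good : ((q + m) ^_ q <= #|good|)%N.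
Proof.
have <- : #|[set f : {ffun 'I_q -> 'I_(q + m)} | injectiveb f]%SET| = ((q + m) ^_ q)%N.
  by rewrite card_inj_ffuns !card_ord.
pose L (f : {ffun 'I_q -> 'I_(q + m)}) : {ffun 'I_q -> 'I_N} :=
  [ffun j => lift ord0 (f j)].
have LI : injective L.
  by move=> f g /ffunP fg; apply/ffunP => j; have := fg j; rewrite !ffunE => /lift_inj.
rewrite -(card_imset _ LI); apply/subset_leq_card/fintype.subsetP => g.
move=> /imsetP[f]; rewrite !inE => /injectiveP fI ->; apply/andP; split.
  by apply/injectiveP => j k; rewrite !ffunE => /lift_inj/fI.
by apply/forallP => j; rewrite ffunE eq_sym neq_lift.
Qed.

(** Each index map contributes the expectation of a variable in [0, 1], so a map outside [good]
    costs at most 1, while a good one costs nothing by [EG_good]. *)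
Lemma exchangeable_average :
  `|\int[P]_w (u (X w) * \prod_j (N%:R^-1 * \sum_i h j (X w, Y i w)))
    - \int[P]_w (u (X w) * \prod_j h j (X w, Y (lift ord0 (lshift m j)) w))|
  <= 1 - ((q + m) ^_ q)%:R / N%:R ^+ q.
Proof.
have N0 : (0 : R) < N%:R by [].
have iG phi : P.-integrable setT (EFin \o G phi) by exact: unit_integrable.
have -> : \int[P]_w (u (X w) * \prod_j (N%:R^-1 * \sum_i h j (X w, Y i w))) =
    N%:R^-1 ^+ q * \sum_(phi : {ffun 'I_q -> 'I_N}) \int[P]_w G phi w.
  rewrite -(Rintegral_sum _ (fun phi : {ffun _} => iG phi)) -RintegralZl//; last first.
    have := integrable_sum measurableT (index_enum {ffun 'I_q -> 'I_N})
      (P := xpredT) (fun (phi : {ffun 'I_q -> 'I_N}) _ => iG phi).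
    by apply: eq_integrable => // w _ /=; rewrite -sumEFin.
  apply: eq_Rintegral => w _.
  rewrite big_split/= prodr_const card_ord bigA_distr_bigA/=.
  by rewrite mulrCA -mulr_sumr.
set a := \int[P]_w _.
have Ea phi : phi \in good -> \int[P]_w G phi w = a.
  by rewrite inE => /andP[/injectiveP pI /forallP p0]; exact: EG_good.
have cardT : (\sum_(phi : {ffun 'I_q -> 'I_N}) 1 : R) = N%:R ^+ q.
  by rewrite sumr_const card_ffun !card_ord natrX.
have -> : N%:R^-1 ^+ q * (\sum_(phi : {ffun 'I_q -> 'I_N}) \int[P]_w G phi w) - a =
    N%:R^-1 ^+ q * (\sum_(phi in (~: good)%SET) (\int[P]_w G phi w - a)).
  transitivity (N%:R^-1 ^+ q *
      \sum_(phi : {ffun 'I_q -> 'I_N}) (\int[P]_w G phi w - a)).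
    rewrite sumrB mulrBr; congr (_ - _).
    have -> : \sum_(phi : {ffun 'I_q -> 'I_N}) a = N%:R ^+ q * a.
      by rewrite -cardT mulr_suml; apply: eq_bigr => phi _; rewrite mul1r.
    by rewrite mulrA -exprMn mulVf ?expr1n ?mul1r// gt_eqF.
  rewrite (bigID (mem good))/= big1 ?add0r; last first.
    by move=> phi /Ea ->; rewrite subrr.
  by congr (_ * _); apply: eq_bigl => phi; rewrite finset.in_setC.
have iN0 : 0 <= N%:R^-1 ^+ q :> R by rewrite exprn_ge0// invr_ge0 ltW.
rewrite normrM (ger0_norm iN0).
rewrite (@le_trans _ _ (N%:R^-1 ^+ q * #|(~: good)%SET|%:R))//.
  rewrite ler_wpM2l//.
  rewrite (le_trans (ler_norm_sum _ _ _))//.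
  rewrite -[leRHS]sumr_const; apply: ler_sum => phi _.
  have := unit_Rintegral P (mG phi) (G01 phi).
  have := unit_Rintegral P (mG first_entries) (G01 first_entries).
  by rewrite -/a ler_norml; lra.
have goodN : (#|good| <= N ^ q)%N.
  by rewrite (leq_trans (max_card _))// card_ffun !card_ord.
rewrite cardsCs finset.setCK card_ffun !card_ord natrB//.
rewrite mulrBr exprVn natrX mulVf ?gt_eqF ?exprn_gt0// lerD2l lerN2.
by rewrite [leRHS]mulrC ler_wpM2r ?invr_ge0 ?exprn_ge0// ler_nat.
Qed.

End exchangeable_average.

(** * Extending a probability space by conditionally i.i.d. coordinates *)

Section semidirect_product.
Context d d' (Om : measurableType d) (T : measurableType d') (R : realType)
  (P : probability Om R) (k : Om -> probability T R).
Hypothesis mk : forall B, measurable B ->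
  measurable_fun [set: Om] (fun w => k w B).

Let kern : Om -> {measure set T -> \bar R} := k.

HB.instance Definition _ := @isKernel.Build _ _ Om T R kern mk.

Let kern_setT w : kern w setT = 1%E. Proof. exact: probability_setT. Qed.

HB.instance Definition _ := @Kernel_isProbability.Build _ _ Om T R kern kern_setT.

Let mpair w : measurable_fun [set: T] (pair w : T -> Om * T).
Proof. exact: measurable_pair1. Qed.

Let fiber w : giry (Om * T)%type R := giry_map (mpair w) (k w).

Let mfiber : measurable_fun [set: Om] fiber.
Proof.
apply: measurable_giry_codensity => // B mB.
have := measurable_fun_xsection_finite_kernel kern (mem_set mB).
by apply: eq_measurable_fun => w _; rewrite xsectionE.
Qed.

(** The measure P(dw) k(w, dy), as the mixture over [w] of the images of [k w] under y -> (w, y). *)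
Definition semidirect_fun : set (Om * T) -> \bar R := giry_bind P mfiber.

HB.instance Definition _ := Measure.on semidirect_fun.

Let semidirect_setT : semidirect_fun setT = 1%E.
Proof.
transitivity (\int[P]_w fiber w setT)%E; first exact: giry_bindE.
rewrite (eq_integral (cst 1%E)) => [|w _]; last exact: probability_setT.
by rewrite integral_cst// mul1e; exact: probability_setT.
Qed.

HB.instance Definition _ := Measure_isProbability.Build _ _ _ semidirect_fun
  semidirect_setT.

Definition semidirect : probability (Om * T)%type R := semidirect_fun.

Lemma integral_semidirect (f : Om * T -> \bar R) :
  measurable_fun [set: Om * T] f -> (forall z, 0 <= f z)%E ->
  (\int[semidirect]_z f z = \int[P]_w \int[k w]_y f (w, y))%E.
Proof.
move=> mf f0; transitivity (giry_int (giry_bind P mfiber) f) => //.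
rewrite giry_int_bind//; apply: eq_integral => w _.
exact: (giry_int_map (mpair w)).
Qed.

End semidirect_product.

Lemma measurable_indic_comp d d' (Om : measurableType d) (T : measurableType d')
    (R : realType) (V : Om -> T) (A : set T) :
  measurable_fun [set: Om] V -> measurable A ->
  measurable_fun [set: Om] (fun w => \1_A (V w) : R).
Proof.
move=> mV mA; have mi : measurable_fun [set: T] (\1_A : T -> R).
  exact: measurable_indic.
exact: measurableT_comp mi mV.
Qed.

(* Adjoin one conditionally independent coordinate at a time. *)
Lemma conditionally_iid_extension d d' (Om : measurableType d)
    (T : measurableType d') (R : realType) (P : probability Om R)
    (k : Om -> probability T R) (q : nat) :
  (forall B, measurable B -> measurable_fun [set: Om] (fun w => k w B)) ->
  exists (d2 : measure_display) (Om2 : measurableType d2)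
    (P2 : probability Om2 R) (pi : Om2 -> Om) (Z : 'I_q -> Om2 -> T),
    [/\ measurable_fun [set: Om2] pi, forall j, measurable_fun [set: Om2] (Z j) &
      forall (A : set Om) (B : 'I_q -> set T), measurable A ->
        (forall j, measurable (B j)) ->
        (\int[P2]_w (\1_A (pi w) * \prod_j \1_(B j) (Z j w))%:E =
         \int[P]_w (\1_A w * \prod_j fine (k w (B j)))%:E)%E].
Proof.
move=> mk; elim: q => [|q [d2 [Om2 [P2 [pi [Z [mpi mZ IH]]]]]]].
  exists d, Om, P, id, (fun _ _ => point); split=> //.
  by move=> A B mA _; apply: eq_integral => w _; rewrite !big_ord0.
have mkpi B : measurable B -> measurable_fun [set: Om2] (fun w => k (pi w) B).
  by move=> mB; exact: measurableT_comp (mk B mB) mpi.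
(* The new coordinate takes index [ord0] and shifts the others. Its law [k (pi w)] depends on the
   old point only through [pi], whence the conditional independence. *)
exists _, (Om2 * T)%type, (semidirect P2 mkpi), (pi \o fst),
  (fun j z => if unlift ord0 j is Some i then Z i z.1 else z.2); split.
- exact: measurableT_comp.
- by move=> j; case: unlift => [i|]//; exact: measurableT_comp.
move=> A B mA mB.
have ZE z : \prod_j \1_(B j) (if unlift ord0 j is Some i then Z i z.1 else z.2) =
    \1_(B ord0) z.2 * \prod_i \1_(B (lift ord0 i)) (Z i z.1) :> R.
  rewrite big_ord_recl unlift_none; congr (_ * _).
  by apply: eq_bigr => i _; rewrite liftK.
under eq_integral do rewrite ZE.
rewrite integral_semidirect; last 2 first.
- apply/measurable_EFinP; apply: measurable_funM.
    by apply: measurable_indic_comp => //; exact: measurableT_comp.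
  apply: measurable_funM; first exact: measurable_indic_comp.
  apply: measurable_prod => i _.
  by apply: measurable_indic_comp => //; exact: measurableT_comp.
- move=> z; rewrite lee_fin !mulr_ge0 ?prodr_ge0//.
pose W1 w := \prod_i \1_(B (lift ord0 i)) (Z i w) : R.
pose W2 w := \prod_i fine (k w (B (lift ord0 i))).
pose f w := \1_A w * fine (k w (B ord0)).
(* Integrating out the new coordinate leaves [f], which is not an indicator; [weighted_law_unique]
   extends the induction hypothesis from sets to such functions. *)
transitivity (\int[P2]_w (W1 w * f (pi w))%:E)%E.
  apply: eq_integral => w _ /=.
  transitivity (\int[k (pi w)]_y ((W1 w * \1_A (pi w))%:E * (\1_(B ord0) y)%:E))%E.
    by apply: eq_integral => y _; rewrite -EFinM /W1; congr (_%:E); ring.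
  rewrite ge0_integralZl_EFin//; last 2 first.
  - exact/measurable_EFinP/measurable_indic.
  - by rewrite mulr_ge0// prodr_ge0.
  by rewrite integral_indic// setIT /f mulrA [in RHS]EFinM fineK// fin_num_measure.
have fk01 B0 : measurable B0 -> unit_valued (fun w => fine (k w B0)).
  move=> mB0 w; rewrite fine_ge0//= -lee_fin fineK ?fin_num_measure//.
  exact: probability_le1.
have mfk B0 : measurable B0 -> measurable_fun [set: Om] (fun w => fine (k w B0)).
  by move=> mB0; exact: measurableT_comp (mk B0 mB0).
have mW2 : measurable_fun [set: Om] W2.
  by apply: measurable_prod => i _; exact: mfk.
transitivity (\int[P]_w (W2 w * f w)%:E)%E; last first.
  apply: eq_integral => w _; congr (_%:E).
  by rewrite big_ord_recl /W2 /f; ring.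
have mf : measurable_fun [set: Om] f.
  by apply: measurable_funM; [exact: measurable_indic|exact: mfk].
apply: (weighted_law_unique (V1 := pi) (V2 := id)) => //.
- by apply: measurable_prod => i _; exact: measurable_indic_comp.
- exact: (@unit_prod _ _ _ xpredT (fun i w => \1_(B (lift ord0 i)) (Z i w))
    (fun i w => @unit_indic _ _ _ _)).
- exact: (@unit_prod _ _ _ xpredT _ (fun i => fk01 _ (mB (lift ord0 i)))).
- move=> C mC; under eq_integral do rewrite mulrC.
  by rewrite IH//; apply: eq_integral => w _; rewrite mulrC.
- by apply: unit_mul; [move=> w; exact: unit_indic|exact: fk01].
Qed.

(** The ratio is a product of [q] factors [1 - (i + 1) / (q + m + 1)], and [q] is fixed. *)
Lemma ffact_ratio_cvg (R : realType) (q : nat) :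
  ((q + m) ^_ q)%:R / (q + m).+1%:R ^+ q @[m --> \oo] --> (1 : R).
Proof.
rewrite (_ : (fun _ => _) = fun m =>
    \prod_(i < q) (1 - i.+1%:R / (m + q.+1)%:R : R)).
  rewrite [X in _ --> X](_ : _ = \prod_(i < q) (1 - i.+1%:R * 0)); last first.
    by rewrite big1// => i _; rewrite mulr0 subr0.
  apply: cvg_big => // [z|i _]; first exact: mul_continuous.
  apply: cvgB; first exact: cvg_cst.
  apply: cvgMr; apply/gtr0_cvgV0.
    by near=> m; rewrite ltr0n addnS.
  apply: (cvg_trans _ (@cvgr_idn R)).
  apply: (cvg_comp _ _ (cvg_addnr q.+1)) => //.
apply/funext => m.
rewrite ffact_prod natr_prod -exprVn -[q in _ ^+ q]card_ord -prodr_const -big_split/=.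
apply: eq_bigr => i _.
have iq : (i <= q + m)%N by rewrite (leq_trans (ltnW (ltn_ord i)))// leq_addr.
rewrite natrB// (_ : (m + q.+1)%N = (q + m).+1); last by rewrite addnS addnC.
rewrite -[i.+1]addn1 -[(q + m).+1]addn1 !natrD; field.
by rewrite -natrD natr1 pnatr_eq0.
Unshelve. all: by end_near. Qed.

Lemma measure_preserving_integral d d2 (Om : measurableType d)
    (Om2 : measurableType d2) (R : realType) (P : probability Om R)
    (P2 : probability Om2 R) (pi : Om2 -> Om) (f : Om -> R) :
  measurable_fun [set: Om2] pi ->
  (forall A, measurable A -> P2 (pi @^-1` A) = P A) ->
  measurable_fun [set: Om] f -> unit_valued f ->
  (\int[P2]_w (f (pi w))%:E = \int[P]_w (f w)%:E)%E.
Proof.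
move=> mpi piP mf f01.
have one01 U : unit_valued (cst 1 : U -> R) by move=> w; rewrite /= ler01 lexx.
suff : (\int[P2]_w (cst 1 w * f (pi w))%:E = \int[P]_w (cst 1 w * f w)%:E)%E.
  under eq_integral do rewrite mul1r.
  by move=> ->; apply: eq_integral => w _; rewrite mul1r.
apply: (weighted_law_unique (V1 := pi) (V2 := id)) => // B mB.
under eq_integral do rewrite mul1r; under [in RHS]eq_integral do rewrite mul1r.
have mpB : measurable (pi @^-1` B) by rewrite -[_ @^-1` _]setTI; exact: mpi.
transitivity (P2 (pi @^-1` B)).
  by rewrite -[X in _ = P2 X]setIT -integral_indic.
by rewrite integral_indic// setIT; exact: piP.
Qed.

Lemma measure_preserving_ae d d2 (Om : measurableType d)
    (Om2 : measurableType d2) (R : realType) (P : probability Om R)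
    (P2 : probability Om2 R) (pi : Om2 -> Om) (Q : Om -> Prop) :
  measurable_fun [set: Om2] pi ->
  (forall A, measurable A -> P2 (pi @^-1` A) = P A) ->
  {ae P, forall w, Q w} -> {ae P2, forall w, Q (pi w)}.
Proof.
move=> mpi piP [N [mN N0 QN]]; exists (pi @^-1` N); split.
- by rewrite -[_ @^-1` _]setTI; exact: mpi.
- by rewrite piP.
- by move=> w nQ; exact: QN.
Qed.

Lemma unit_expectationE d (Om : measurableType d) (R : realType)
    (P : probability Om R) (f : Om -> R) :
  measurable_fun [set: Om] f -> unit_valued f ->
  'E_P[f]%E = (\int[P]_w f w)%:E.
Proof. by move=> mf f01; rewrite unlock unit_RintegralE. Qed.

Lemma unit_bounded (R : realType) (U : Type) (f : U -> R) :
  unit_valued f -> bounded_fun f.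
Proof.
move=> f01; exists 1; split=> // M M1 x _ /=; have /andP[f0 f1] := f01 x.
by rewrite ger0_norm// (le_trans f1)// ltW.
Qed.

(** * Mixed moments of the empirical measure and of the tuple *)

Section averages.
Context (R : realType) (XX YY : ptopologicalType)
  (d : nat -> measure_display) (Om : forall n : nat, measurableType (d n))
  (P : forall n : nat, probability (Om n) R)
  (X : forall n : nat, Om n -> XX) (Y : forall n : nat, 'I_n.+1 -> Om n -> YY)
  (beta : nat -> XX -> R) (gamma : nat -> YY -> R).
Hypotheses (bbeta : bump_sequence beta) (bgamma : bump_sequence gamma)
  (rX : forall n : nat, random_element (@X n))
  (rY : forall (n : nat) (i : 'I_n.+1), random_element (@Y n i))
  (exch : forall n, exchangeable_excluding (P n) (@X n) ord0 (@Y n)).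

(** A mixed moment of the empirical measure: the [j]-th factor is the integral of [h j] against it,
    written as a finite sum. *)
Definition avg_int q (u : XX -> R) (h : 'I_q -> XX * YY -> R) n : R :=
  \int[P n]_w (u (X w) * \prod_j (n.+1%:R^-1 * \sum_i h j (X w, Y i w))).

Definition first_int q (u : XX -> R) (h : 'I_q -> XX * YY -> R) m : R :=
  \int[P (q + m)]_w
    (u (X w) * \prod_j h j (X w, Y (lift ord0 (lshift m j)) w)).

(** The two sequences are indexed differently. They are compared along [n = q + m], and a shift by
    [q] does not affect the limit of the averages. *)
Lemma avg_first_cvg q (u : XX -> R) (h : 'I_q -> XX * YY -> R) :
  continuous u -> unit_valued u ->
  (forall j, continuous (h j)) -> (forall j, unit_valued (h j)) ->
  forall L : R,
  first_int u h m @[m --> \oo] --> L <-> avg_int u h n @[n --> \oo] --> L.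
Proof.
move=> cu u01 ch h01 L.
have diff0 : (avg_int u h (q + m) - first_int u h m) @[m --> \oo] --> (0 : R).
  apply/norm_cvg0P.
  apply: (@squeeze_cvgr _ _ _ _ (cst 0)
    (fun m => 1 - ((q + m) ^_ q)%:R / (q + m).+1%:R ^+ q)).
  - apply: nearW => m; rewrite normr_ge0/=.
    exact: (exchangeable_average (@rX (q + m)) (@rY (q + m)) bbeta bgamma
      (@exch (q + m))).
  - exact: cvg_cst.
  - rewrite -[X in _ --> X](subrr 1); apply: cvgB; first exact: cvg_cst.
    exact: ffact_ratio_cvg.
have avgE : (fun m => avg_int u h (q + m)) = (fun m => avg_int u h (m + q)).
  by apply/funext => m; rewrite addnC.
split=> [fL|aL].
  rewrite -(cvg_shiftn q) -avgE (_ : (fun m => avg_int u h (q + m)) =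
    fun m => (avg_int u h (q + m) - first_int u h m) + first_int u h m).
    by rewrite -[L]add0r; exact: cvgD.
  by apply/funext => m; rewrite subrK.
have aL' : avg_int u h (q + m) @[m --> \oo] --> L.
  by rewrite avgE (cvg_shiftn q).
rewrite (_ : first_int u h =
  fun m => avg_int u h (q + m) - (avg_int u h (q + m) - first_int u h m)).
  by rewrite -[L]subr0; exact: cvgB.
by apply/funext => m; rewrite subKr.
Qed.

Context (d' : measure_display) (Om' : measurableType d')
  (P' : probability Om' R) (X' : Om' -> XX) (Y' : Om' -> YY)
  (eta : Om' -> borel_prob R (XX * YY)%type).
Hypotheses (rX' : random_element X') (rY' : random_element Y')
  (etaE : is_cond_law P' X' (fun w => (X' w, Y' w)) eta).

Definition limit_int q (u : XX -> R) (h : 'I_q -> XX * YY -> R) : R :=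
  \int[P']_w (u (X' w) * \prod_j \int[eta w : probability _ R]_x h j x).

Let etam (B : set (borel (XX * YY)%type)) : measurable B ->
  measurable_fun [set: Om'] (fun w => (eta w : probability _ R) B).
Proof. by move=> mB; exact: (cond_law_measurable rX' etaE). Qed.

Lemma limit_integrand q (u : XX -> R) (h : 'I_q -> XX * YY -> R) :
  continuous u -> unit_valued u ->
  (forall j, continuous (h j)) -> (forall j, unit_valued (h j)) ->
  measurable_fun [set: Om']
    (fun w => u (X' w) * \prod_j \int[eta w : probability _ R]_x h j x) /\
  unit_valued (fun w => u (X' w) * \prod_j \int[eta w : probability _ R]_x h j x).
Proof.
move=> cu u01 ch h01; split.
  apply: measurable_funM; first exact: (continuous_random_real cu rX').
  apply: measurable_prod => j _; apply: measurable_Rintegral_kernel => //.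
  exact: continuous_borel_real.
apply: unit_mul; first by move=> w; exact: u01.
apply: (@unit_prod _ _ _ xpredT
  (fun j w => \int[eta w : probability _ R]_x h j x)) => j w.
by apply: unit_Rintegral => //; exact: continuous_borel_real.
Qed.

Section product_of_coordinates.
Context q (u : XX -> R) (h : 'I_q -> XX * YY -> R).
Hypotheses (cu : continuous u) (u01 : unit_valued u)
  (ch : forall j, continuous (h j)) (h01 : forall j, unit_valued (h j)).

Definition coord_prod (z : XX * {ptws 'I_q -> YY}) : R :=
  u z.1 * \prod_j h j (z.1, z.2 j).

Lemma coord_prod_continuous : continuous coord_prod.
Proof.
move=> z; apply: cvgM.
  by apply: (@continuous_comp _ _ _ fst u); [exact: cvg_fst|exact: cu].
apply: (@continuous_prod _ _ _ _
  (fun j (z : XX * {ptws 'I_q -> YY}) => h j (z.1, z.2 j))).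
by move=> j; exact: continuous_coord.
Qed.

Lemma coord_prod_unit : unit_valued coord_prod.
Proof.
apply: unit_mul; first by move=> z; exact: u01.
exact: (@unit_prod _ _ _ xpredT
  (fun j (z : XX * {ptws 'I_q -> YY}) => h j (z.1, z.2 j)) (fun j z => h01 j _)).
Qed.

Lemma coord_prod_measurable d2 (Om2 : measurableType d2) (V : Om2 -> XX)
    (Z : 'I_q -> Om2 -> YY) :
  random_element V -> (forall j, random_element (Z j)) ->
  measurable_fun [set: Om2] (fun w => coord_prod (V w, fun j => Z j w)).
Proof.
move=> rV rZ; apply: measurable_funM.
  exact: (continuous_random_real cu rV).
apply: measurable_prod => j _.
exact: (continuous_random_real (@ch j) (random_element_pair bbeta bgamma rV (rZ j))).
Qed.

(** By conditional independence the integrand may be replaced by a function of [pi w] alone, whose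
    integral can be computed on the original space. *)
Lemma limit_int_extension d2 (Om2 : measurableType d2) (P2 : probability Om2 R)
    (pi : Om2 -> Om') (Z : 'I_q -> Om2 -> YY) :
  measurable_fun [set: Om2] pi ->
  (forall A, measurable A -> P2 (pi @^-1` A) = P' A) ->
  (forall j, random_element (Z j)) ->
  (forall j, is_cond_law P2 (X' \o pi) (fun w => (X' (pi w), Z j w)) (eta \o pi)) ->
  cond_independent P2 (X' \o pi) Z ->
  \int[P2]_w coord_prod (X' (pi w), fun j => Z j w) = limit_int u h.
Proof.
move=> mpi piP rZ clZ ciZ; congr fine.
have rXpi : random_element (X' \o pi) by exact: measurableT_comp rX' mpi.
transitivity (\int[P2]_w ((u \o X' \o pi) w *
    \prod_j \int[eta (pi w) : probability _ R]_x h j x)%:E)%E.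
  apply: (@cond_independent_prod R _ Om2 P2 XX YY (X' \o pi) q Z (eta \o pi)
    _ _ rXpi rZ bbeta bgamma clZ _ ciZ u h) => //.
  - by move=> B mB; exact: measurableT_comp (etam mB) mpi.
  - exact: continuous_borel_real.
  - by move=> j; exact: continuous_borel_real.
have [mf f01] := limit_integrand cu u01 ch h01.
exact: (measure_preserving_integral mpi piP mf f01).
Qed.

Lemma tuple_first_cvg d2 (Om2 : measurableType d2) (P2 : probability Om2 R)
    (pi : Om2 -> Om') (Z : 'I_q -> Om2 -> YY) :
  measurable_fun [set: Om2] pi ->
  (forall A, measurable A -> P2 (pi @^-1` A) = P' A) ->
  (forall j, random_element (Z j)) ->
  (forall j, is_cond_law P2 (X' \o pi) (fun w => (X' (pi w), Z j w)) (eta \o pi)) ->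
  cond_independent P2 (X' \o pi) Z ->
  @cvg_in_dist R (XX * {ptws 'I_q -> YY})%type
    _ _ (fun m => P (q + m))
    (fun m w => (X w, fun j : 'I_q => Y (lift ord0 (lshift m j)) w))
    _ _ P2 (fun w => (X' (pi w), fun j => Z j w)) ->
  first_int u h m @[m --> \oo] --> limit_int u h.
Proof.
move=> mpi piP rZ clZ ciZ.
move=> /(_ coord_prod coord_prod_continuous (unit_bounded coord_prod_unit)).
rewrite unit_expectationE; last 2 first.
- by apply: coord_prod_measurable => //; exact: measurableT_comp rX' mpi.
- by move=> w; exact: coord_prod_unit.
rewrite (limit_int_extension mpi piP rZ clZ ciZ).
rewrite (_ : (fun n => _) = EFin \o first_int u h); first by move=> /fine_cvg.
apply/funext => m; rewrite unit_expectationE//.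
- exact: coord_prod_measurable.
- by move=> w; exact: coord_prod_unit.
Qed.

End product_of_coordinates.

End averages.

Lemma continuous_fun_comp (T U V : topologicalType) (f : T -> U) (g : U -> V) :
  continuous f -> continuous g -> continuous (fun x => g (f x)).
Proof. by move=> cf cg x; exact: (continuous_comp (cf x) (cg (f x))). Qed.

(** * Quadratic deviations and second moments *)

Section quadratic_deviation.
Context (R : realType) (Z : ptopologicalType).
Implicit Types (mu : borel_prob R Z) (L : seq (unit_continuous R Z * R)).

Lemma unit_one_subproof : continuous (cst 1 : Z -> R) /\ unit_valued (cst 1 : Z -> R).
Proof. by split=> [|x]; [exact: cst_continuous|rewrite /= ler01 lexx]. Qed.

(** Every probability gives it integral 1, so the linear and constant terms of an expanded square
    are products of two integrals as well, and [second_moment] covers them all. *)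
Definition unit_one : unit_continuous R Z := exist _ (cst 1) unit_one_subproof.

Lemma unit_integral_one mu : unit_integral mu unit_one = 1.
Proof. by rewrite /unit_integral Rintegral_cst// [X in fine X]probability_setT mul1r. Qed.

Definition deviation (K : R) L mu : R :=
  K * \sum_(fa <- L) (unit_integral mu fa.1 - fa.2) ^+ 2.

Lemma deviation_ge0 K L mu : 0 <= K -> 0 <= deviation K L mu.
Proof. by move=> K0; rewrite mulr_ge0// sumr_ge0// => fa _; exact: sqr_ge0. Qed.

Lemma deviation_bounded K L : exists B, forall mu, `|deviation K L mu| <= B.
Proof.
exists (`|K| * \sum_(fa <- L) (1 + `|fa.2|) ^+ 2) => mu.
rewrite normrM ler_wpM2l// (le_trans (ler_norm_sum _ _ _))// ler_sum// => fa _.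
have /andP[f0 f1] := unit_integral01 mu fa.1.
rewrite normrX lerXn2r ?nnegrE ?addr_ge0//.
by rewrite (le_trans (ler_normB _ _))// lerD2r ger0_norm.
Qed.

Lemma deviation_continuous K L : continuous (deviation K L).
Proof.
have c2 (a : R) : continuous (fun x : R => (x - a) ^+ 2).
  move=> x; apply: (@continuous_comp _ _ _ (fun x : R => x - a) (fun x : R => x ^+ 2)).
    by apply: cvgB; [exact: cvg_id|exact: cvg_cst].
  exact: exprn_continuous.
have cK : continuous (fun x : R => K * x).
  by move=> x; apply: cvgMr; exact: cvg_id.
apply: (continuous_fun_comp (g := fun x : R => K * x) _ cK).
apply: continuous_sum => fa.
apply: (continuous_fun_comp (g := fun x : R => (x - fa.2) ^+ 2) _ (c2 fa.2)).
exact: unit_integral_continuous.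
Qed.

Context d (Om : measurableType d) (P : probability Om R) (U : Om -> R)
  (m : Om -> borel_prob R Z).
Hypotheses (mU : measurable_fun [set: Om] U) (U01 : unit_valued U)
  (mm : forall f, measurable_fun [set: Om] (fun w => unit_integral (m w) f)).

Definition second_moment (f g : unit_continuous R Z) : R :=
  \int[P]_w (U w * (unit_integral (m w) f * unit_integral (m w) g)).

Lemma measurable_deviation K L :
  measurable_fun [set: Om] (fun w => deviation K L (m w)).
Proof.
apply: measurable_funM => //; apply: measurable_sum => fa.
by apply: measurable_funX; exact: measurable_funB.
Qed.

Lemma integral_deviation K L :
  \int[P]_w (U w * deviation K L (m w)) =
  K * \sum_(fa <- L) (second_moment fa.1 fa.1
    - 2 * fa.2 * second_moment fa.1 unit_one
    + fa.2 ^+ 2 * second_moment unit_one unit_one).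
Proof.
have i2 f g : P.-integrable setT
    (EFin \o (fun w => U w * (unit_integral (m w) f * unit_integral (m w) g))).
  apply: unit_integrable.
    by apply: measurable_funM => //; exact: measurable_funM.
  by apply: unit_mul => //; apply: unit_mul => w; exact: unit_integral01.
have iZ c f g : P.-integrable setT (EFin \o (fun w =>
    c * (U w * (unit_integral (m w) f * unit_integral (m w) g)))).
  have := integrableZl measurableT c (i2 f g); exact: eq_integrable.
have termE fa : \int[P]_w (U w * (unit_integral (m w) fa.1 - fa.2) ^+ 2) =
    second_moment fa.1 fa.1 - 2 * fa.2 * second_moment fa.1 unit_one
    + fa.2 ^+ 2 * second_moment unit_one unit_one.
  rewrite /second_moment -!RintegralZl// -RintegralB// -RintegralD//.
    by apply: eq_Rintegral => w _; rewrite unit_integral_one; ring.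
  have := integrableB measurableT (i2 fa.1 fa.1) (iZ (2 * fa.2) fa.1 unit_one).
  by apply: eq_integrable.
have iterm fa : P.-integrable setT
    (EFin \o (fun w => U w * (unit_integral (m w) fa.1 - fa.2) ^+ 2)).
  apply: (@bounded_integrable _ _ _ _ _ ((1 + `|fa.2|) ^+ 2)).
    by apply: measurable_funM => //; apply: measurable_funX; exact: measurable_funB.
  move=> w; have /andP[f0 f1] := unit_integral01 (m w) fa.1.
  have /andP[U0 U1] := U01 w.
  rewrite normrM ger0_norm// -[leRHS]mul1r ler_pM// normrX.
  rewrite lerXn2r ?nnegrE ?addr_ge0// (le_trans (ler_normB _ _))// lerD2r.
  by rewrite ger0_norm.
under eq_bigr do rewrite -termE.
rewrite -(Rintegral_sum _ iterm) -RintegralZl//.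
  apply: eq_Rintegral => w _; rewrite /deviation mulrCA; congr (_ * _).
  by rewrite mulr_sumr.
have := integrable_sum measurableT L (P := xpredT) (fun fa _ => iterm fa).
by apply: eq_integrable => // w _ /=; rewrite -sumEFin.
Qed.

End quadratic_deviation.

Lemma bump_part_continuous (R : realType) (T : topologicalType) (b : nat -> T -> R) l :
  (forall l, continuous (b l)) -> continuous (bump_part b l).
Proof.
move=> cb x; apply: cvgM; first exact: cb.
apply: (@continuous_prod _ _ _ _ (fun (i : 'I_l) x => 1 - b i x)) => i {}x.
by apply: cvgB; [exact: cvg_cst|exact: cb].
Qed.

(** * From two-factor moments to convergence of the empirical measure *)

Section empirical_convergence.
Context (R : realType) (XX YY : ptopologicalType)
  (d : nat -> measure_display) (Om : forall n : nat, measurableType (d n))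
  (P : forall n : nat, probability (Om n) R)
  (X : forall n : nat, Om n -> XX) (Y : forall n : nat, 'I_n.+1 -> Om n -> YY)
  (beta : nat -> XX -> R) (gamma : nat -> YY -> R)
  (d' : measure_display) (Om' : measurableType d')
  (P' : probability Om' R) (X' : Om' -> XX) (Y' : Om' -> YY)
  (eta : Om' -> borel_prob R (XX * YY)%type).
Hypotheses (bbeta : bump_sequence beta) (bgamma : bump_sequence gamma)
  (rX : forall n : nat, random_element (@X n))
  (rY : forall (n : nat) (i : 'I_n.+1), random_element (@Y n i))
  (rX' : random_element X')
  (etaE : is_cond_law P' X' (fun w => (X' w, Y' w)) eta)
  (cont_eta : depends_continuously P' X' eta)
  (avg_limit : forall (u : XX -> R) (h : 'I_2 -> XX * YY -> R),
    continuous u -> unit_valued u ->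
    (forall j, continuous (h j)) -> (forall j, unit_valued (h j)) ->
    avg_int P X Y u h n @[n --> \oo] --> limit_int P' X' eta u h).

Let Z : ptopologicalType := (XX * YY)%type.
Let emp n (w : Om n) : borel_prob R Z := empirical R (fun j => (X w, Y j w)).

Let emp_measurable n (f : unit_continuous R Z) :
  measurable_fun [set: Om n] (fun w => unit_integral (emp w) f).
Proof.
have [cf f01] := svalP f.
rewrite (_ : (fun w => _) =
    fun w => n.+1%:R^-1 * \sum_i sval f (X w, Y i w)); last first.
  by apply/funext => w; exact: integral_empirical.
apply: measurable_funM => //; apply: measurable_sum => i.
exact: (continuous_random_real cf (random_element_pair bbeta bgamma (@rX n) (@rY n i))).
Qed.

Let eta_measurable (f : unit_continuous R Z) :
  measurable_fun [set: Om'] (fun w => unit_integral (eta w) f).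
Proof.
have [cf f01] := svalP f; apply: measurable_Rintegral_kernel => //.
- by move=> B mB; exact: (cond_law_measurable rX' etaE).
- exact: continuous_borel_real.
Qed.

Let second_moment_cvg (u : XX -> R) (f g : unit_continuous R Z) :
  continuous u -> unit_valued u ->
  second_moment (P n) (u \o @X n) (@emp n) f g @[n --> \oo] -->
  second_moment P' (u \o X') eta f g.
Proof.
move=> cu u01; have [[cf f01] [cg g01]] := (svalP f, svalP g).
pose h (j : 'I_2) := if j == ord0 then sval f else sval g.
have := @avg_limit u h cu u01 _ _.
rewrite (_ : limit_int _ _ _ _ _ = second_moment P' (u \o X') eta f g); last first.
  apply: eq_Rintegral => w _.
  by rewrite big_ord_recl big_ord_recl big_ord0 mulr1.
rewrite (_ : avg_int _ _ _ _ _ =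
    fun n => second_moment (P n) (u \o @X n) (@emp n) f g); last first.
  apply/funext => n; apply: eq_Rintegral => w _.
  rewrite big_ord_recl big_ord_recl big_ord0 mulr1/=.
  by rewrite /unit_integral !integral_empirical.
by apply=> j; rewrite /h; case: ifP.
Qed.

Let deviation_cvg (u : XX -> R) K L : continuous u -> unit_valued u ->
  \int[P n]_w (u (X w) * deviation K L (emp w)) @[n --> \oo] -->
  \int[P']_w (u (X' w) * deviation K L (eta w)).
Proof.
move=> cu u01.
rewrite (@integral_deviation _ _ _ _ P' (u \o X') eta) //; last 2 first.
- exact: (continuous_random_real cu rX').
- by move=> w; exact: u01.
rewrite (_ : (fun n => _) = fun n => K * \sum_(fa <- L)
   (second_moment (P n) (u \o @X n) (@emp n) fa.1 fa.1
    - 2 * fa.2 * second_moment (P n) (u \o @X n) (@emp n) fa.1 (unit_one R Z)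
    + fa.2 ^+ 2 * second_moment (P n) (u \o @X n) (@emp n)
        (unit_one R Z) (unit_one R Z))); last first.
  apply/funext => n.
  rewrite (@integral_deviation _ _ _ _ (P n) (u \o @X n) (@emp n)) //.
  - exact: (continuous_random_real cu (@rX n)).
  - by move=> w; exact: u01.
apply: cvgMr; apply: cvg_sumr => fa; apply: cvgD; last first.
  by apply: cvgMr; exact: second_moment_cvg.
by apply: cvgB; [|apply: cvgMr]; exact: second_moment_cvg.
Qed.

(** The second moment of the constant 1 with itself. *)
Let law_cvg (u : XX -> R) : continuous u -> unit_valued u ->
  \int[P n]_w u (X w) @[n --> \oo] --> \int[P']_w u (X' w).
Proof.
move=> cu u01; have := @second_moment_cvg u (unit_one R Z) (unit_one R Z) cu u01.
rewrite /second_moment; under eq_Rintegral do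
  rewrite !unit_integral_one !mulr1.
apply: cvg_trans; apply: near_eq_cvg; apply: nearW => n /=.
by apply: eq_Rintegral => w _; rewrite !unit_integral_one !mulr1.
Qed.

(* On the support of [b], [F] is controlled by a quadratic functional of the
   measure, whose value along [phi] is small. *)
Let local_control (F : XX * borel_prob R Z -> R) (phi : XX -> borel_prob R Z)
    (e : R) (b : XX -> R) (c K : R) L : Prop :=
  0 <= K /\ forall x, b x != 0 ->
    (forall mu, `|F (x, mu) - c| <= e + deviation K L mu) /\
    deviation K L (phi x) <= e.

Let local_controlP (F : XX * borel_prob R Z -> R) (phi : XX -> borel_prob R Z)
    (M e : R) (x : XX) :
  continuous F -> (forall z, `|F z| <= M) -> 0 < M -> 0 < e ->
  {for x, continuous phi} ->
  exists l c K L, beta l x = 1 /\ local_control F phi e (beta l) c K L.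
Proof.
move=> cF FM M0 e0 cphi.
have /cvgrPdist_lt/(_ _ e0) := cF (x, phi x).
move=> [[/= U W] [nU /weak_nbhs[fs [r [r0 rW]]]] UW].
(* With this [K], a deviation below [2 M] forces the sum of squares below [r] and hence [mu] into
   [W]; a larger one dominates the trivial bound [2 M] on [|F - c|]. *)
pose K := 2 * M / r; pose L := [seq (f, unit_integral (phi x) f) | f <- fs].
have devE mu : deviation K L mu = K *
    \sum_(f <- fs) (unit_integral mu f - unit_integral (phi x) f) ^+ 2.
  by rewrite /deviation big_map.
have K0 : 0 <= K by rewrite divr_ge0 ?mulr_ge0 ?ltW.
(* The deviation is centred at [phi x], so along [phi] it vanishes at [x]; continuity of [phi] at
   this one point keeps it small nearby. *)
have nphi : nbhs x [set x' | deviation K L (phi x') < e].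
  have : {for x, continuous (deviation K L \o phi)}.
    by apply: continuous_comp => //; exact: deviation_continuous.
  move=> /cvgrPdist_lt/(_ _ e0); apply: filterS => x' /=.
  rewrite devE big1 ?mulr0 ?sub0r ?normrN; last by move=> f _; rewrite subrr expr0n.
  by move=> h; rewrite (le_lt_trans (ler_norm _)).
have [_ _ /(_ x _ (filterI nU nphi))[l lx lU]] := bbeta.
exists l, (F (x, phi x)), K, L; split=> //; split=> // x' /lU[Ux' phix'].
split; last exact: ltW.
move=> mu; have [small|big] := ltP (deviation K L mu) (2 * M).
  have /rW Wmu : \sum_(f <- fs)
      (unit_integral mu f - unit_integral (phi x) f) ^+ 2 < r.
    move: small; rewrite devE /K mulrAC ltr_pdivrMr//.
    by rewrite mulrC [ltRHS]mulrC ltr_pM2r// mulr_gt0.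
  have := UW (x', mu) (conj Ux' Wmu); rewrite distrC => /ltW h.
  by rewrite (le_trans h)// lerDl deviation_ge0.
rewrite (le_trans (ler_normB _ _))//.
by have := FM (x', mu); have := FM (x, phi x); lra.
Qed.

Lemma empirical_convergence : empirical_cvg P X Y P' X' eta.
Proof.
move=> F cF /bounded_funP[M M0 FM].
have [phi [phic phiE]] := cont_eta.
apply: (@cvg_expectation_bumps _ _ _ _ _ _ _
  (fun n => F \o (fun w => (X w, emp w))) (F \o (fun w => (X' w, eta w))) M).
- by move=> n w; exact: FM.
- by move=> w; exact: FM.
(* One half of [e] is for the oscillation of [F], the other for the deviation of [phi]. *)
move=> e e0; have e2 : 0 < e / 2 by rewrite divr_gt0.
pose good l := exists c K L, local_control F phi (e / 2) (beta l) c K L.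
have /choice[D DP] l : exists D : (XX -> R) * (R * R * seq (unit_continuous R Z * R)),
    [/\ continuous D.1, unit_valued D.1,
      local_control F phi (e / 2) D.1 D.2.1.1 D.2.1.2 D.2.2 &
      (good l -> D.1 = beta l)].
  have [cb b01 _] := bbeta.
  have [[c [K [L g]]]|ng] := pselect (good l).
    by exists (beta l, (c, K, L)); split=> //=.
  (* Bumps without control are replaced by 0, so that every index satisfies the bounds; each point
     of continuity of [phi] still has a controlled bump equal to 1 there. *)
  exists (cst 0, (0, 0, [::])); split=> //=.
  - exact: cst_continuous.
  - by move=> x; rewrite lexx ler01.
  - by split=> // x; rewrite eqxx.
pose b l := (D l).1; pose c l := (D l).2.1.1.
pose K l := (D l).2.1.2; pose L l := (D l).2.2.
have cb l : continuous (b l) by case: (DP l).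
have b01 l : unit_valued (b l) by case: (DP l).
have ctrl l : local_control F phi (e / 2) (b l) (c l) (K l) (L l) by case: (DP l).
have K0 l : 0 <= K l by case: (ctrl l).
have /choice[B HB] l := deviation_bounded (Z := Z) (K l) (L l).
(* [eta] and [phi (X')] agree on all Borel sets off a single null set, which therefore serves every
   [l]. *)
have etaphi : {ae P', forall w, forall l, deviation (K l) (L l) (eta w) =
    deviation (K l) (L l) (phi (X' w))}.
  apply: filterS phiE => w h l; congr (_ * _); apply: eq_bigr => fa _.
  by congr ((_ - _) ^+ 2); apply: eq_unit_integral => B' mB'; rewrite h.
exists (fun n l w => b l (X w)), (fun n l w => deviation (K l) (L l) (emp w)),
  (fun l w => b l (X' w)), c, B; split.
- split.
  + by move=> n l; exact: (continuous_random_real (cb l) (@rX n)).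
  + by move=> n l w; exact: b01.
  + by move=> l; exact: (continuous_random_real (cb l) rX').
  + by move=> l w; exact: b01.
- split.
  + by move=> n l; exact: measurable_deviation.
  + by move=> n l w; exact: HB.
  + move=> n w l; have [->|bx] := eqVneq (b l (X w)) 0; first by rewrite !mul0r.
    have [_ /(_ _ bx)[h _]] := ctrl l.
    rewrite ler_wpM2l//; first by case/andP: (b01 l (X w)).
    by have /= := h (emp w); lra.
- apply: filterS etaphi => w h l.
  have [->|bx] := eqVneq (b l (X' w)) 0; first by rewrite !mul0r.
  have [_ /(_ _ bx)[h1 h2]] := ctrl l.
  rewrite ler_wpM2l//; first by case/andP: (b01 l (X' w)).
  by have /= := h1 (eta w); rewrite h; lra.
- apply: filterS phic => w /(local_controlP cF FM M0 e2)[l [c' [K' [L' [lx g]]]]].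
  exists l; have [_ _ _] := DP l; rewrite /b => -> //.
  by exists c', K', L'.
have cbp l : continuous (bump_part b l) by exact: bump_part_continuous.
have bp01 l : unit_valued (bump_part b l) by exact: bump_part_unit.
split=> l; first exact: (law_cvg (cbp l) (bp01 l)).
(* In the limit the deviation is that of [phi (X')], at most [e / 2] on the support of [b l]. *)
exists (\int[P']_w (bump_part b l (X' w) * deviation (K l) (L l) (eta w)));
  last exact: (@deviation_cvg _ (K l) (L l) (cbp l) (bp01 l)).
have mbp : measurable_fun [set: Om'] (fun w => bump_part b l (X' w)).
  exact: (continuous_random_real (cbp l) rX').
have ibp : P'.-integrable setT (EFin \o (fun w => bump_part b l (X' w))).
  by apply: unit_integrable => // w; exact: bp01.
rewrite -RintegralZl//; apply: ae_le_Rintegral.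
- apply: (@bounded_integrable _ _ _ _ _ (B l)).
    by apply: measurable_funM => //; exact: measurable_deviation.
  move=> w; have /andP[p0 p1] := bp01 l (X' w).
  by rewrite normrM ger0_norm// -[leRHS]mul1r ler_pM.
- have := integrableZl measurableT e ibp; exact: eq_integrable.
apply: filterS etaphi => w h.
have /andP[p0 _] := bp01 l (X' w).
have [bx|bx] := eqVneq (b l (X' w)) 0.
  by rewrite /bump_part bx !mul0r mulr0.
rewrite mulrC ler_wpM2r//.
have [_ /(_ _ bx)[h1 h2]] := ctrl l.
by rewrite h; lra.
Qed.

End empirical_convergence.

(** * Construction of the limit tuple *)

Section tuple_limit.
Context (R : realType) (XX YY : ptopologicalType)
  (beta : nat -> XX -> R) (gamma : nat -> YY -> R)
  (d' : measure_display) (Om' : measurableType d')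
  (P' : probability Om' R) (X' : Om' -> XX) (Y' : Om' -> YY)
  (eta : Om' -> borel_prob R (XX * YY)%type).
Hypotheses (bbeta : bump_sequence beta) (bgamma : bump_sequence gamma)
  (rX' : random_element X') (rY' : random_element Y')
  (etaE : is_cond_law P' X' (fun w => (X' w, Y' w)) eta).

Local Notation Z := (XX * YY)%type.

Let etam (B : set (borel Z)) : measurable B ->
  measurable_fun [set: Om'] (fun w => (eta w : probability _ R) B).
Proof. by move=> mB; exact: (cond_law_measurable rX' etaE). Qed.

Let eta_fst (A : set (borel XX)) (C : set (borel YY)) :
  measurable A -> measurable C ->
  {ae P', forall w, fine ((eta w : probability _ R) (A `*` C)) =
    \1_A (X' w) * fine ((eta w : probability _ R) (setT `*` C))}.
Proof.
exact: (@cond_law_fst R _ Om' P' XX YY X' 1 (fun _ => Y') eta beta gamma rX'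
  (fun=> rY') bbeta bgamma (fun=> etaE) ord0).
Qed.

Let fine_eta01 (B : set (borel Z)) : measurable B ->
  unit_valued (fun w => fine ((eta w : probability _ R) B)).
Proof.
move=> mB w; rewrite fine_ge0//= -lee_fin fineK ?fin_num_measure//.
exact: probability_le1.
Qed.

Let mfine_eta (B : set (borel Z)) : measurable B ->
  measurable_fun [set: Om'] (fun w => fine ((eta w : probability _ R) B)).
Proof. by move=> mB; exact: measurableT_comp (etam mB). Qed.

Let mrect (A : set (borel XX)) (C : set (borel YY)) :
  measurable A -> measurable C -> @measurable _ (borel Z) (A `*` C).
Proof.
by move=> mA mC; apply: borel_rect_measurable; exists A => //; exists C.
Qed.

(** Pairs are drawn conditionally i.i.d. from [eta], and only their second entries are kept, next to
    [X'] itself. Nothing is lost, because the first marginal of [eta] is almost surely the Dirac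
    mass at [X']. *)
Lemma cond_iid_extension q :
  exists (d2 : measure_display) (Om2 : measurableType d2)
    (P2 : probability Om2 R) (pi : Om2 -> Om') (Yl : 'I_q -> Om2 -> YY),
    [/\ measurable_fun setT pi /\
          (forall A, measurable A -> P2 (pi @^-1` A) = P' A),
        (forall j, random_element (Yl j)),
        (forall j, is_cond_law P2 (X' \o pi) (fun w => (X' (pi w), Yl j w))
                     (eta \o pi)) &
        cond_independent P2 (X' \o pi) Yl].
Proof.
have [d2 [Om2 [P2 [pi [V [mpi mV PV]]]]]] := @conditionally_iid_extension _ _ Om'
  (borel Z) R P' (fun w => eta w : probability _ R) q etam.
pose Yl j w := (V j w).2.
have mX (A : set (borel XX)) : measurable A -> measurable (X' @^-1` A).
  by move=> mA; rewrite -[_ @^-1` _]setTI; exact: rX'.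
have piP A : measurable A -> P2 (pi @^-1` A) = P' A.
  move=> mA; have := PV A (fun=> setT) mA (fun=> measurableT).
  have -> : (\int[P2]_w (\1_A (pi w) * \prod_j \1_[set: Z] (V j w))%:E =
      \int[P2]_w (\1_(pi @^-1` A) w)%:E)%E.
    apply: eq_integral => w _; congr (_%:E).
    by rewrite big1 ?mulr1// => j _; rewrite indicT.
  have -> : (\int[P']_w (\1_A w *
      \prod_(j < q) fine ((eta w : probability _ R) setT))%:E =
      \int[P']_w (\1_A w)%:E)%E.
    apply: eq_integral => w _; congr (_%:E).
    by rewrite big1 ?mulr1// => j _; rewrite [X in fine X]probability_setT.
  rewrite !integral_indic// ?setIT//.
  by rewrite -[_ @^-1` _]setTI; exact: mpi.
have rXpi : random_element (X' \o pi) by exact: measurableT_comp rX' mpi.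
have rYl j : random_element (Yl j).
  have m2 : measurable_fun [set: borel Z] (snd : borel Z -> borel YY).
    by apply: continuous_borel => z; exact: cvg_snd.
  exact: measurableT_comp m2 (mV j).
have rVl j : random_element (fun w => (X' (pi w), Yl j w)).
  exact: (random_element_pair bbeta bgamma rXpi (rYl j)).
have PY (A : set (borel XX)) (C : 'I_q -> set (borel YY)) :
    measurable A -> (forall j, measurable (C j)) ->
    (\int[P2]_w (\1_A (X' (pi w)) * \prod_j \1_(C j) (Yl j w))%:E =
     \int[P2]_w (\1_A (X' (pi w)) *
       \prod_j fine ((eta (pi w) : probability _ R) (setT `*` C j)))%:E)%E.
  move=> mA mC.
  have mTC j : @measurable _ (borel Z) (setT `*` C j) by exact: mrect.
  have := PV _ _ (mX _ mA) mTC.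
  rewrite -(measure_preserving_integral mpi piP); last 2 first.
  - apply: measurable_funM; first by apply: measurable_indic; exact: mX.
    by apply: measurable_prod => j _; exact: mfine_eta.
  - apply: unit_mul; first exact: unit_indic.
    exact: (@unit_prod _ _ _ xpredT _ (fun j => fine_eta01 (mTC j))).
  move=> <-; apply: eq_integral => w _; congr ((_ * _)%:E).
  apply: eq_bigr => j _; rewrite !indicE; congr (_%:R).
  by congr nat_of_bool; apply/idP/idP; rewrite !inE /Yl /=; [|case].
have clYl j : is_cond_law P2 (X' \o pi) (fun w => (X' (pi w), Yl j w)) (eta \o pi).
  move=> B mB; split.
    have [mg _] := etaE mB; move=> _ U mU.
    have [C mC CU] := mg measurableT U mU; exists C => //.
    by move: CU; rewrite !setTI => /(congr1 (fun S => pi @^-1` S)).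
  move=> A mA; have mXA : measurable ((X' \o pi) @^-1` A).
    by rewrite -[_ @^-1` _]setTI; exact: rXpi.
  rewrite integral_preimage probability_preimage//; last first.
    by rewrite -[_ @^-1` _]setTI; exact: rVl.
  have mW : measurable_fun [set: Om2] (fun w => \1_A ((X' \o pi) w) : R).
    exact: (@measurable_indic_comp _ _ Om2 (borel XX) R _ A rXpi mA).
  have W01 : unit_valued (fun w => \1_A ((X' \o pi) w) : R).
    by move=> w; exact: unit_indic.
  have etaI E w : @measurable _ (borel Z) E ->
      \int[eta (pi w) : probability _ R]_x \1_E x =
      fine ((eta (pi w) : probability _ R) E).
    by move=> mE; rewrite Rintegral_indic.
  transitivity (\int[P2]_w (\1_A ((X' \o pi) w) *
      \int[eta (pi w) : probability _ R]_x \1_B x)%:E)%E.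
    by apply: eq_integral => w _; rewrite etaI.
  apply/esym.
  apply: (@dirac_mixture_unique _ _ _ Om2 Om2 (borel Z) R P2 P2
    (fun w => (X' (pi w), Yl j w)) _ _ (fun w => eta (pi w) : probability _ R)
    (@borel_rect XX YY)) => //.
  - exact: rVl.
  - by move=> B' mB'; exact: measurableT_comp (etam mB') mpi.
  - exact: (borel_prodE bbeta bgamma).
  - exact: borel_rect_setI.
  - exact: borel_rectT.
  - move=> _ [A2 mA2 [C mC <-]].
    (* Coordinate [j] is isolated by leaving the other constraints trivial; [eta_fst] accounts for
       the side [A2]. *)
    pose C' i := if i == j then C else setT.
    have mC' i : @measurable _ (borel YY) (C' i) by rewrite /C'; case: ifP.
    have mAA2 : measurable (A `&` A2) by exact: measurableI.
    transitivity (\int[P2]_w (\1_(A `&` A2) (X' (pi w)) *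
        \prod_i \1_(C' i) (Yl i w))%:E)%E.
      apply: eq_integral => w _; congr (_%:E).
      rewrite (bigD1 j)//= big1 ?mulr1; last first.
        by move=> i /negbTE ij; rewrite /C' ij indicT.
      rewrite /C' eqxx indicI/= -mulrA; congr (_ * _).
      rewrite !indicE -natrM mulnb; congr (_%:R); congr nat_of_bool.
      by apply/idP/andP; rewrite !inE.
    rewrite PY//.
    have mAC := mrect mA2 mC.
    apply: ae_eq_integral => //.
    + apply/measurable_EFinP; apply: measurable_funM.
        exact: (@measurable_indic_comp _ _ Om2 (borel XX) R _ _ rXpi mAA2).
      apply: measurable_prod => i _.
      exact: measurableT_comp (mfine_eta (mrect measurableT (mC' i))) mpi.
    + apply/measurable_EFinP; apply: measurable_funM => //.
      under eq_fun do rewrite etaI//.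
      exact: measurableT_comp (mfine_eta mAC) mpi.
    have := measure_preserving_ae mpi piP (eta_fst mA2 mC).
    apply: filterS => w h _; congr (_%:E); rewrite etaI// h indicI/= -mulrA.
    congr (_ * (_ * _)); rewrite (bigD1 j)//= big1 ?mulr1.
      by rewrite /C' eqxx.
    move=> i /negbTE ij; rewrite /C' ij setXTT.
    by rewrite [X in fine X]probability_setT.
  - exact: unit_indic.
exists d2, Om2, P2, pi, Yl; split=> //.
move=> C g mC gC.
have mTC j : @measurable _ (borel Z) (setT `*` C j) by exact: mrect.
(* The product rule is about arbitrary versions; by uniqueness they agree almost surely with those
   read off from [eta]. *)
have gE : {ae P2, forall w, forall j,
    g j w = fine ((eta (pi w) : probability _ R) (setT `*` C j))}.
  apply: filter_forall => j.
  apply: (cond_prob_unique rXpi _ (gC j)).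
    by rewrite -[_ @^-1` _]setTI; exact: rYl.
  have := clYl j _ (mTC j); congr (is_cond_prob _ _ _ _).
  by apply/seteqP; split => w /=; [case|].
split.
  by apply: measurable_prod => j _; have [] := gC j.
move=> A mA.
have mXA : measurable ((X' \o pi) @^-1` A).
  by rewrite -[_ @^-1` _]setTI; exact: rXpi.
have mYC : measurable (\bigcap_(j in [set: 'I_q]) Yl j @^-1` C j).
  apply: fin_bigcap_measurable => // j _.
  by rewrite -[_ @^-1` _]setTI; exact: rYl.
rewrite integral_preimage probability_preimage//.
transitivity (\int[P2]_w (\1_A (X' (pi w)) * \prod_j \1_(C j) (Yl j w))%:E)%E;
  last first.
  by apply: eq_integral => w _; rewrite indic_bigcap.
rewrite PY//; apply: ae_eq_integral => //.
- apply/measurable_EFinP; apply: measurable_funM.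
    exact: (@measurable_indic_comp _ _ Om2 (borel XX) R _ A rXpi mA).
  apply: measurable_prod => j _; have [+ _] := gC j.
  exact: preimage_measurable_fun.
- apply/measurable_EFinP; apply: measurable_funM.
    exact: (@measurable_indic_comp _ _ Om2 (borel XX) R _ A rXpi mA).
  by apply: measurable_prod => j _; exact: measurableT_comp (mfine_eta (mTC j)) mpi.
apply: filterS gE => w h _; congr ((_ * _)%:E).
by apply: eq_bigr => j _.
Qed.

End tuple_limit.

(** * From the empirical measure to convergence of tuples *)

Section tuple_convergence.
Context (R : realType) (XX YY : ptopologicalType)
  (d : nat -> measure_display) (Om : forall n : nat, measurableType (d n))
  (P : forall n : nat, probability (Om n) R)
  (X : forall n : nat, Om n -> XX) (Y : forall n : nat, 'I_n.+1 -> Om n -> YY)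
  (beta : nat -> XX -> R) (gamma : nat -> YY -> R)
  (d' : measure_display) (Om' : measurableType d')
  (P' : probability Om' R) (X' : Om' -> XX) (Y' : Om' -> YY)
  (eta : Om' -> borel_prob R (XX * YY)%type).
Hypotheses (bbeta : bump_sequence beta) (bgamma : bump_sequence gamma)
  (rX : forall n : nat, random_element (@X n))
  (rY : forall (n : nat) (i : 'I_n.+1), random_element (@Y n i))
  (rX' : random_element X') (rY' : random_element Y')
  (etaE : is_cond_law P' X' (fun w => (X' w, Y' w)) eta)
  (exch : forall n, exchangeable_excluding (P n) (@X n) ord0 (@Y n)).

Lemma empirical_avg_cvg q (u : XX -> R) (h : 'I_q -> XX * YY -> R) :
  empirical_cvg P X Y P' X' eta ->
  continuous u -> unit_valued u ->
  (forall j, continuous (h j)) -> (forall j, unit_valued (h j)) ->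
  avg_int P X Y u h n @[n --> \oo] --> limit_int P' X' eta u h.
Proof.
move=> emp_cvg cu u01 ch h01.
pose hu j : unit_continuous R (XX * YY)%type := exist _ (h j) (conj (@ch j) (@h01 j)).
pose F (z : XX * borel_prob R (XX * YY)%type) := u z.1 * \prod_j unit_integral z.2 (hu j).
have cF : continuous F.
  have c1 : continuous (fun z : XX * borel_prob R (XX * YY)%type => u z.1).
    by move=> z; apply: (@continuous_comp _ _ _ fst u); [exact: cvg_fst|exact: cu].
  have c2 : continuous (fun z : XX * borel_prob R (XX * YY)%type =>
      \prod_j unit_integral z.2 (hu j)).
    apply: continuous_prod => j.
    have cs : continuous (snd : XX * borel_prob R (XX * YY)%type -> _).
      by move=> z; exact: cvg_snd.
    exact: (continuous_fun_comp cs (@unit_integral_continuous _ _ (hu j))).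
  by move=> z; exact: (continuousM (c1 z) (c2 z)).
have F01 : unit_valued F.
  apply: unit_mul; first by move=> z; exact: u01.
  exact: (@unit_prod _ _ _ xpredT
    (fun j (z : XX * borel_prob R (XX * YY)%type) => unit_integral z.2 (hu j))
    (fun j z => unit_integral01 _ _)).
have := emp_cvg F cF (unit_bounded F01).
have [mlim lim01] := limit_integrand rX' etaE cu u01 ch h01.
rewrite unit_expectationE; [|exact: mlim|by move=> w; exact: F01].
rewrite (_ : (fun n => _) = EFin \o avg_int P X Y u h).
  by move=> /fine_cvg.
apply/funext => n.
have FE (w : Om n) : F (X w, empirical R (fun j => (X w, Y j w))) =
    u (X w) * \prod_j (n.+1%:R^-1 * \sum_i h j (X w, Y i w)).
  congr (_ * _); apply: eq_bigr => j _; rewrite /unit_integral/=.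
  by apply: integral_empirical; [exact: ch|exact: h01].
(* Measurability of the composite comes from its explicit form as a product of finite sums, not from
   that of the empirical measure as a random element. *)
have mF : measurable_fun [set: Om n]
    (F \o (fun w => (X w, empirical R (fun j => (X w, Y j w))))).
  rewrite (_ : _ \o _ = fun w => u (X w) *
    \prod_j (n.+1%:R^-1 * \sum_i h j (X w, Y i w))); last exact/funext.
  apply: measurable_funM; first exact: (continuous_random_real cu (@rX n)).
  apply: measurable_prod => j _; apply: measurable_funM => //.
  apply: measurable_sum => i.
  exact: (continuous_random_real (@ch j)
    (random_element_pair bbeta bgamma (@rX n) (@rY n i))).
rewrite (unit_expectationE _ mF) /=; last by move=> w; exact: F01.
by congr (_%:E); congr (Rintegral _ _ _); exact/funext.
Qed.

Context q d2 (Om2 : measurableType d2) (P2 : probability Om2 R)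
  (pi : Om2 -> Om') (Yl : 'I_q -> Om2 -> YY).
Hypotheses (mpi : measurable_fun [set: Om2] pi)
  (piP : forall A, measurable A -> P2 (pi @^-1` A) = P' A)
  (rYl : forall j, random_element (Yl j))
  (clYl : forall j, is_cond_law P2 (X' \o pi) (fun w => (X' (pi w), Yl j w)) (eta \o pi))
  (ciYl : cond_independent P2 (X' \o pi) Yl)
  (emp_cvg : empirical_cvg P X Y P' X' eta).

Local Notation S := (XX * {ptws 'I_q -> YY})%type.
Let V m (w : Om (q + m)) : S := (X w, fun j : 'I_q => Y (lift ord0 (lshift m j)) w).
Let V' (w : Om2) : S := (X' (pi w), fun j => Yl j w).

Definition test_data : Type :=
  {uh : (XX -> R) * ('I_q -> XX * YY -> R) |
    [/\ continuous uh.1, unit_valued uh.1,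
        (forall j, continuous (uh.2 j)) & (forall j, unit_valued (uh.2 j))]}.

Definition test_fun (t : test_data) : S -> R := coord_prod (sval t).1 (sval t).2.

Let test_cont t : continuous (test_fun t).
Proof. by have [cu _ ch _] := svalP t; exact: coord_prod_continuous. Qed.

Let test_unit t : unit_valued (test_fun t).
Proof. by have [_ u01 _ h01] := svalP t; exact: coord_prod_unit. Qed.

Let test_mV m t : measurable_fun [set: Om (q + m)] (test_fun t \o @V m).
Proof.
have [cu _ ch _] := svalP t.
exact: (coord_prod_measurable bbeta bgamma cu ch (@rX (q + m)) (fun j => @rY (q + m) _)).
Qed.

Let test_mV' t : measurable_fun [set: Om2] (test_fun t \o V').
Proof.
have [cu _ ch _] := svalP t.
have rXpi : random_element (X' \o pi) by exact: measurableT_comp rX' mpi.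
exact: (coord_prod_measurable bbeta bgamma cu ch rXpi rYl).
Qed.

Let test_cvg t : \int[P (q + m)]_w test_fun t (V w) @[m --> \oo] -->
  \int[P2]_w test_fun t (V' w).
Proof.
have [cu u01 ch h01] := svalP t.
rewrite (limit_int_extension bbeta bgamma rX' etaE cu u01 ch h01 mpi piP rYl clYl ciYl).
apply/(avg_first_cvg bbeta bgamma rX rY exch cu u01 ch h01).
exact: empirical_avg_cvg.
Qed.

(** Stability under products is what makes the parts of a partition of unity accessible, since
    [1 - test_fun t] need not be a test function. *)
Let test_mul (s t : test_data) : exists r, test_fun r = (fun z => test_fun s z * test_fun t z).
Proof.
have [[cu u01 ch h01] [cv v01 ck k01]] := (svalP s, svalP t).
have H : [/\ continuous (fun x => (sval s).1 x * (sval t).1 x),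
    unit_valued (fun x => (sval s).1 x * (sval t).1 x),
    (forall j, continuous (fun z => (sval s).2 j z * (sval t).2 j z)) &
    (forall j, unit_valued (fun z => (sval s).2 j z * (sval t).2 j z))].
  split.
  - by move=> x; exact: (continuousM (cu x) (cv x)).
  - exact: unit_mul.
  - by move=> j z; exact: (continuousM (ch j z) (ck j z)).
  - by move=> j; exact: unit_mul.
exists (exist _ (_, fun j z => (sval s).2 j z * (sval t).2 j z) H).
by apply/funext => z; rewrite /test_fun /coord_prod/= big_split/=; ring.
Qed.

(** Induction on [l]: multiplying out the last factor leaves a difference of two integrals with one
    factor less, the second with [t] replaced by a product of test functions. *)
Let test_rest_cvg (b : nat -> test_data) l t :
  \int[P (q + m)]_w (test_fun t (V w) * \prod_(i < l) (1 - test_fun (b i) (V w)))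
    @[m --> \oo] -->
  \int[P2]_w (test_fun t (V' w) * \prod_(i < l) (1 - test_fun (b i) (V' w))).
Proof.
pose rest l z := \prod_(i < l) (1 - test_fun (b i) z).
have rest01 k : unit_valued (rest k).
  exact: (@unit_prod _ _ _ xpredT (fun (i : 'I_k) z => 1 - test_fun (b i) z)
    (fun i => @unit_onem _ _ (fun i => test_fun (b i)) (fun i => @test_unit (b i)) i)).
have step d3 (Om3 : measurableType d3) (P3 : probability Om3 R) (W : Om3 -> S) k s r :
    (forall t, measurable_fun [set: Om3] (test_fun t \o W)) ->
    test_fun r = (fun z => test_fun s z * test_fun (b k) z) ->
    \int[P3]_w (test_fun s (W w) * rest k.+1 (W w)) =
    \int[P3]_w (test_fun s (W w) * rest k (W w)) -
    \int[P3]_w (test_fun r (W w) * rest k (W w)).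
  move=> mW rE.
  have i1 t' : P3.-integrable setT (EFin \o (fun w => test_fun t' (W w) * rest k (W w))).
    apply: unit_integrable.
      apply: measurable_funM; first exact: mW.
      apply: (@measurable_prod_cond _ _ _ _ xpredT
        (fun (i : 'I_k) w => 1 - test_fun (b i) (W w))) => i.
      by apply: measurable_funB => //; exact: mW.
    by apply: unit_mul => w; [exact: test_unit|exact: rest01].
  rewrite -RintegralB//; apply: eq_Rintegral => w _.
  by rewrite rE /rest big_ord_recr/=; ring.
elim: l t => [|l IH] t.
  under [X in _ --> X]eq_Rintegral do rewrite big_ord0 mulr1.
  rewrite (_ : (fun m => _) = fun m => \int[P (q + m)]_w test_fun t (V w)).
    exact: test_cvg.
  by apply/funext => m; apply: eq_Rintegral => w _; rewrite big_ord0 mulr1.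
have [r rE] := test_mul t (b l).
have := step _ _ P2 V' l t r test_mV' rE; rewrite /rest => ->.
rewrite (_ : (fun m => _) = fun m =>
  \int[P (q + m)]_w (test_fun t (V w) * rest l (V w)) -
  \int[P (q + m)]_w (test_fun r (V w) * rest l (V w))).
  by apply: cvgB; exact: IH.
by apply/funext => m; exact: (step _ _ _ _ _ _ _ (@test_mV m) rE).
Qed.

Lemma tuple_convergence :
  @cvg_in_dist R S _ _ (fun m => P (q + m)) (fun m w => V w) _ _ P2 V'.
Proof.
move=> F cF /bounded_funP[M M0 FM].
apply: (@cvg_expectation_bumps R _ (fun m => Om (q + m)) (fun m => P (q + m)) _ _ P2
  (fun m => F \o @V m) (F \o V') M).
- by move=> n w; exact: FM.
- by move=> w; exact: FM.
move=> e e0.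
pose near_cst (b : S -> R) (c : R) := forall z, b z != 0 -> `|F z - c| <= e.
have [cb b01 bb] := bbeta; have [cg g01 gg] := bgamma.
(* One bump per coordinate. The indices form a countable type because [q] is finite, and numbers
   that code no index give 0. *)
pose box (l : nat) : S -> R := if unpickle l is Some ik then
  coord_prod (beta (ik : nat * {ffun 'I_q -> nat}).1)
    (fun j z => gamma (ik.2 j) z.2) else cst 0.
have zero_test : exists t, test_fun t = cst 0.
  have H : [/\ continuous (cst 0 : XX -> R), unit_valued (cst 0 : XX -> R),
      (forall j : 'I_q, continuous (cst 0 : XX * YY -> R)) &
      (forall j : 'I_q, unit_valued (cst 0 : XX * YY -> R))].
    by split=> [|z|j|j z]; rewrite /= ?lexx ?ler01//; exact: cst_continuous.
  exists (exist _ (cst 0, fun=> cst 0) H).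
  by apply/funext => z; rewrite /test_fun /coord_prod/= mul0r.
have box_test l : exists t, test_fun t = box l.
  rewrite /box; case: unpickle => [[i k]|//].
  have H : [/\ continuous (beta i), unit_valued (beta i),
    (forall j : 'I_q, continuous (fun z : XX * YY => gamma (k j) z.2)) &
    (forall j : 'I_q, unit_valued (fun z : XX * YY => gamma (k j) z.2))].
    split; [exact: cb|exact: b01| |by move=> j z; exact: g01].
    by move=> j z; apply: (@continuous_comp _ _ _ snd (gamma (k j)));
      [exact: cvg_snd|exact: cg].
  by exists (exist _ (_, fun j z => gamma (k j) z.2) H).
have /choice[D DP] l : exists D : test_data * R, near_cst (test_fun D.1) D.2 /\
    ((exists c, near_cst (box l) c) -> test_fun D.1 = box l).
  have [[c g]|ng] := pselect (exists c, near_cst (box l) c).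
    by have [t tE] := box_test l; exists (t, c); rewrite /= tE.
  (* Boxes on which [F] varies too much are discarded. *)
  have [t tE] := zero_test; exists (t, 0); split=> //= z.
  by rewrite tE eqxx.
pose b l := test_fun (D l).1.
have bc l : near_cst (b l) (D l).2 by case: (DP l).
have b_unit l : unit_valued (b l) by exact: test_unit.
have bFc z l : b l z * `|F z - (D l).2| <= b l z * e.
  have [->|bz] := eqVneq (b l z) 0; first by rewrite !mul0r.
  by rewrite ler_wpM2l ?bc//; case/andP: (b_unit l z).
(* No measure enters [F], so the random error is 0. *)
exists (fun m l w => b l (V w)), (fun _ _ => cst 0), (fun l w => b l (V' w)),
  (fun l => (D l).2), (fun=> 0); split.
- split.
  + by move=> m l; exact: test_mV.
  + by move=> m l w; exact: b_unit.
  + by move=> l; exact: test_mV'.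
  + by move=> l w; exact: b_unit.
- split.
  + by move=> m l; exact: measurable_cst.
  + by move=> m l w; rewrite normr0.
  + by move=> m w l; rewrite addr0.
- by apply: aeW => w l.
- apply: aeW => w.
  (* Around every point, continuity of [F] gives a product neighbourhood, and the bumps give a box
     equal to 1 at the point and supported in it. *)
  have /cvgrPdist_lt/(_ _ e0) := cF (V' w).
  move=> [[/= U W] [nU /ptws_nbhs_box[B nB BW]] UW].
  have [i ix iU] := bb _ _ nU.
  have /choice[k kP] j : exists k, gamma k ((V' w).2 j) = 1 /\
      forall y, gamma k y != 0 -> B j y.
    by have [k kx kB] := gg _ _ (nB j); exists k.
  pose l := pickle (i, [ffun j => k j]).
  have boxE z : box l z = beta i z.1 * \prod_j gamma (k j) (z.2 j).
    by rewrite /box pickleK /coord_prod/=; under eq_bigr do rewrite ffunE.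
  exists l; rewrite /b; have [_ ->] := DP l.
    by rewrite boxE ix mul1r big1// => j _; case: (kP j).
  exists (F (V' w)) => z; rewrite boxE mulf_eq0 negb_or => /andP[bz gz].
  rewrite distrC ltW//; apply: (UW z); split; first exact: iU.
  apply: BW => j; have [_] := kP j; apply.
  by move/prodf_neq0 : gz => /(_ j isT).
split=> l.
  exact: (@test_rest_cvg (fun i => (D i).1) l (D l).1).
exists 0.
  apply: mulr_ge0; first exact: ltW.
  apply: Rintegral_ge0 => w _.
  by have /andP[] := @bump_part_unit _ _ (fun l w => b l (V' w)) (fun l w => b_unit l _) l w.
rewrite (_ : (fun m => _) = cst 0); first exact: cvg_cst.
apply/funext => m; under eq_Rintegral do rewrite mulr0.
by rewrite Rintegral_cst// mul0r.
Qed.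

End tuple_convergence.

Theorem proposition5p5 (R : realType) (XX YY : ptopologicalType)
    (polishX : polish R XX) (lcX : locally_compact [set: XX])
    (polishY : polish R YY) (lcY : locally_compact [set: YY])
    (d : nat -> measure_display) (Om : forall n : nat, measurableType (d n))
    (P : forall n : nat, probability (Om n) R)
    (X : forall n : nat, Om n -> XX)
    (Y : forall n : nat, 'I_n.+1 -> Om n -> YY)
    (rX : forall n : nat, random_element (X n))
    (rY : forall (n : nat) (i : 'I_n.+1), random_element (Y n i))
    (d' : measure_display) (Om' : measurableType d') (P' : probability Om' R)
    (X' : Om' -> XX) (Y' : Om' -> YY)
    (rX' : random_element X') (rY' : random_element Y')
    (eta : Om' -> borel_prob R (XX * YY)%type)
    (etaE : is_cond_law P' X' (fun w => (X' w, Y' w)) eta)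
    (conv : convenient P X Y P' X' eta) :
  (empirical_cvg P X Y P' X' eta <->
     forall k : nat, (3 <= k)%N -> tuple_cvg P X Y P' X' eta k) /\
  (tuple_cvg P X Y P' X' eta 3 -> empirical_cvg P X Y P' X' eta).
Proof.
have [beta bbeta] := polish_bump_sequence polishX.
have [gamma bgamma] := polish_bump_sequence polishY.
have [exch cont_eta] := conv.
(* For [k = 3] the tuple has two entries, which yields exactly the moments with two factors. *)
have pair_cvg : tuple_cvg P X Y P' X' eta 3 -> empirical_cvg P X Y P' X' eta.
  move=> [d2 [Om2 [P2 [pi [Yl [[mpi piP] rYl clYl ciYl cvg]]]]]].
  apply: (empirical_convergence bbeta bgamma rX rY rX' etaE cont_eta).
  move=> u h cu u01 ch h01.
  apply/(avg_first_cvg bbeta bgamma rX rY exch cu u01 ch h01).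
  exact: (tuple_first_cvg bbeta bgamma rX rY rX' etaE cu u01 ch h01
    mpi piP rYl clYl ciYl cvg).
split=> //; split=> [emp_cvg k _|/(_ 3 isT)//].
(* The limit tuple is existentially quantified in [tuple_cvg], so it is built before convergence is
   proved. *)
have [d2 [Om2 [P2 [pi [Yl [[mpi piP] rYl clYl ciYl]]]]]] :=
  cond_iid_extension bbeta bgamma rX' rY' etaE k.-1.
exists d2, Om2, P2, pi, Yl; split=> //.
exact: (tuple_convergence bbeta bgamma rX rY rX' etaE exch
  mpi piP rYl clYl ciYl emp_cvg).
Qed.
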